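(* Let $(b,0)$ be a connected weighted graph over $V$ and let $m:V\to(0,\infty)$ be an arbitrary measure of full support. Let $Q^{(D)}$ be the regular Dirichlet form associated with $(b,0)$ on $\ell^2(V,m)$. The random walk associated with $(b,0)$ is recurrent if and only if $Q^{(D)}$ is recurrent.
   Context: $V$ is an infinite countable set. A weighted graph $(b,c)$ over $V$ consists of $b:V\times V\to[0,\infty)$ with $b(x,x)=0$, $b(x,y)=b(y,x)$ and $\sum_{y\in V}b(x,y)<\infty$ for all $x,y\in V$, and $c:V\to[0,\infty)$; $(b,0)$ means $c\equiv 0$. Write $x\sim y$ if $b(x,y)>0$. The graph is connected if any two vertices $x,y$ are joined by a finite sequence $x=x_0\sim x_1\sim\dots\sim x_n=y$. $\deg(x)=\sum_{y\in V}b(x,y)+c(x)$. $C_c(V)$ is the set of finitely supported real functions on $V$; $\delta_x$ is the function equal to $1$ at $x$ and $0$ elsewhere. The random walk associated with $(b,0)$ is the $V$-valued discrete time Markov chain $(X_n)_{n\ge0}$ with transition probabilities $\mathbb{P}(X_{n+1}=y\mid X_n=x)=b(x,y)/\deg(x)$ for all $x,y\in V$, $n\ge 0$. It is called recurrent if $\mathbb{P}(X_n=y\text{ infinitely often}\mid X_0=x)=1$ for all $x,y\in V$. For $u:V\to\mathbb{R}$ let $\widetilde Q(u)=\frac12\sum_{x,y\in V}b(x,y)(u(x)-u(y))^2+\sum_{x\in V}c(x)u(x)^2\in[0,\infty]$, $\widetilde D=\{u:V\to\mathbb{R}:\widetilde Q(u)<\infty\}$, extended to a bilinear form on $\widetilde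 D$ in the natural way. $\ell^2(V,m)$ has inner product $\langle f,g\rangle=\sum_x f(x)g(x)m(x)$. The regular Dirichlet form $Q^{(D)}$ associated with the graph on $\ell^2(V,m)$ is the restriction of $\widetilde Q$ to the closure $D(Q^{(D)})$ of $C_c(V)$ in $\widetilde D\cap\ell^2(V,m)$ with respect to $\|u\|_Q=(\widetilde Q(u)+\|u\|_2^2)^{1/2}$. $L^{(D)}$ is the associated nonnegative self-adjoint operator ($u\in D(L^{(D)})$ and $L^{(D)}u=w$ iff $u\in D(Q^{(D)})$, $w\in\ell^2(V,m)$ and $Q^{(D)}(u,v)=\langle w,v\rangle$ for all $v\in D(Q^{(D)})$). $Q^{(D)}$ is called recurrent if its semigroup is, i.e. if $\int_0^\infty e^{-tL^{(D)}}\delta_x(y)\,dt=\infty$ for all $x,y\in V$. *)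

(* Defs.v *)
From HB Require Import structures.
From mathcomp Require Import all_boot all_order all_algebra.
From mathcomp Require Import all_classical all_reals all_analysis.
Import Order.TTheory GRing.Theory Num.Theory.
Import numFieldNormedType.Exports.

Set Implicit Arguments.
Unset Strict Implicit.
Unset Printing Implicit Defensive.

Local Open Scope classical_set_scope.
Local Open Scope ring_scope.

Section WeightedGraph.
Context {R : realType} {V : countType}.
Implicit Types (b : V -> V -> R) (c m u v w f g : V -> R) (x y : V).

Definition weighted_graph b c : Prop :=
  [/\ forall x y, 0 <= b x y,
      forall x, b x x = 0,
      forall x y, b x y = b y x,
      forall x, (\esum_(y in [set: V]) (b x y)%:E < +oo)%E
    & forall x, 0 <= c x].

Definition connected_graph b : Prop :=
  forall x y, exists s : seq V,
    path [rel z z' | 0 < b z z'] x s /\ last x s = y.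

Definition deg b c x : R := fine (\esum_(y in [set: V]) (b x y)%:E)%E + c x.

Definition delta x : V -> R := fun y => (y == x)%:R.

Definition finitely_supported u : Prop := finite_set [set x | u x != 0].

(* [esum] is only meaningful for nonnegative families; the sum of an absolutely
   summable real family is the difference of the sums of its positive and
   negative parts. *)
Definition sum_real (I : choiceType) (a : I -> R) : R :=
  fine (\esum_(i in [set: I]) (Num.max (a i) 0)%:E)%E -
  fine (\esum_(i in [set: I]) (Num.max (- a i) 0)%:E)%E.

Definition energy b c u : \bar R :=
  ((2^-1)%:E *
     (\esum_(p in [set: V * V]) (b p.1 p.2 * (u p.1 - u p.2) ^+ 2)%:E) +
   \esum_(x in [set: V]) (c x * u x ^+ 2)%:E)%E.

Definition finite_energy b c u : Prop := (energy b c u < +oo)%E.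

Definition energy_form b c u v : R :=
  2^-1 * sum_real (fun p : V * V =>
           b p.1 p.2 * (u p.1 - u p.2) * (v p.1 - v p.2)) +
  sum_real (fun x => c x * u x * v x).

Definition l2sum m u : \bar R := (\esum_(x in [set: V]) (u x ^+ 2 * m x)%:E)%E.

Definition in_l2 m u : Prop := (l2sum m u < +oo)%E.

Definition l2norm m u : R := Num.sqrt (fine (l2sum m u)).

Definition l2inner m f g : R := sum_real (fun x => f x * g x * m x).

Definition Qnorm b c m u : R :=
  Num.sqrt (fine (energy b c u) + fine (l2sum m u)).

(* The form Q^(D): its domain, the form itself being [energy_form]
   restricted to it. *)
Definition dom_QD b c m u : Prop :=
  [/\ finite_energy b c u, in_l2 m u
    & forall e : R, 0 < e -> exists2 phi : V -> R,
        finitely_supported phi & Qnorm b c m (u \- phi) < e].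

(* The graph of the operator L^(D): [op_LD b c m u w] means that u is in
   D(L^(D)) and L^(D) u = w. *)
Definition op_LD b c m u w : Prop :=
  [/\ dom_QD b c m u, in_l2 m w
    & forall v, dom_QD b c m v -> energy_form b c u v = l2inner m w v].

(* [semigroup_of m L T]: (T t)_{t >= 0} is the semigroup e^{-tL} on l^2(V,m),
   i.e. the strongly continuous semigroup of symmetric contractions whose
   generator is -L (with the same domain), L being given by its graph. Values
   of T outside t >= 0 and l^2(V,m) are irrelevant. *)
Record semigroup_of m (L : (V -> R) -> (V -> R) -> Prop)
    (T : R -> (V -> R) -> (V -> R)) : Prop := SemigroupOf {
  semigroup_l2 : forall (t : R) f, 0 <= t -> in_l2 m f -> in_l2 m (T t f) ;
  semigroup_linear : forall (t a : R) f g, 0 <= t -> in_l2 m f -> in_l2 m g ->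
    T t (fun x => a * f x + g x) = (fun x => a * T t f x + T t g x) ;
  semigroup_symmetric : forall (t : R) f g, 0 <= t -> in_l2 m f -> in_l2 m g ->
    l2inner m (T t f) g = l2inner m f (T t g) ;
  semigroup_contraction : forall (t : R) f, 0 <= t -> in_l2 m f ->
    l2norm m (T t f) <= l2norm m f ;
  semigroup0 : forall f, in_l2 m f -> T 0 f = f ;
  semigroupD : forall (s t : R) f, 0 <= s -> 0 <= t -> in_l2 m f ->
    T (s + t) f = T s (T t f) ;
  semigroup_continuous : forall f, in_l2 m f ->
    l2norm m (T t f \- f) @[t --> 0^'+] --> (0 : R) ;
  semigroup_generator : forall u w, L u w <->
    [/\ in_l2 m u, in_l2 m w
      & l2norm m (fun x => t^-1 * (u x - T t u x) - w x) @[t --> 0^'+]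
          --> (0 : R)] }.

Definition recurrent_semigroup (T : R -> (V -> R) -> (V -> R)) : Prop :=
  forall x y,
    (\int[lebesgue_measure]_(t in `[0%R, +oo[) (T t (delta x) y)%:E = +oo)%E.

End WeightedGraph.

Section RandomWalk.
Context {R : realType} {V : countType}.

Definition cond_prob d (Omega : measurableType d) (P : probability Omega R)
  (A B : set Omega) : R := fine (P (A `&` B)) / fine (P B).

(* [X] is a Markov chain under [P] with the transition probabilities of the
   graph (b,0); V carries the discrete sigma-algebra. Every vertex is charged by
   the law of X_0, so that conditioning on X_0 = x makes sense for all x. *)
Record random_walk (b : V -> V -> R) d (Omega : measurableType d)
    (P : probability Omega R) (X : nat -> Omega -> V) : Prop := RandomWalk {
  walk_measurable : forall n (A : set V), measurable (X n @^-1` A) ;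
  walk_start : forall x, (0 < P (X 0%N @^-1` [set x]))%E ;
  walk_markov : forall n (s : nat -> V) (y : V),
    let past := [set o | forall k, (k <= n)%N -> X k o = s k] in
    (0 < P past)%E ->
    cond_prob P (X n.+1 @^-1` [set y]) past
      = b (s n) y / deg b (fun=> 0) (s n) }.

Definition recurrent_walk d (Omega : measurableType d)
    (P : probability Omega R) (X : nat -> Omega -> V) : Prop :=
  forall x y,
    cond_prob P [set o | forall N, exists2 n, (N <= n)%N & X n o = y]
      (X 0%N @^-1` [set x]) = 1.

End RandomWalk.

(* Main.v *)
(* For a vertex [z] let cap(z) be the infimum of the energy Q(phi) over the finitely
   supported phi with phi(z) = 1. Both notions of recurrence are equivalent to
   cap(z) = 0 for all z.

   Random walk. The Green function of the walk killed outside a finite set K is a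
   finitely supported function u with Q(u) <= deg(x) u(x); if cap(x) > 0 this bounds
   u(x) uniformly in K, so that the expected number of visits to x is finite and the
   walk is transient by Borel-Cantelli. Conversely the probability h of ever hitting y
   is a positive superharmonic function; by the ground state transform it would yield
   cap(z) > 0 at every vertex z where it is not harmonic. If all capacities vanish, h
   is harmonic with maximum h(y) = 1, so h = 1 by connectedness and the walk returns
   to y infinitely often.

   Semigroup. Let U_s be the integral of T_t f over [0, s] and I(s) = <f, U_s>. As
   L U_s = f - T_s f, one has Q(U_s) <= I(s). If <f, phi>^2 <= C Q(phi) for all finitely
   supported phi, then by density I(s)^2 <= C I(s), hence I(s) <= C. Conversely if
   I <= M, then T_s f tends to 0 and Cauchy-Schwarz applied to
   Q(U_s, phi) = <f, phi> - <T_s f, phi> yields <f, phi>^2 <= M Q(phi). With f = delta_x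
   this settles the diagonal. For x <> y, connectedness bounds (phi(x) - phi(y))^2 by
   C Q(phi), so the integral of <T_t g, g> is finite for g = delta_x/m(x) - delta_y/m(y),
   and polarization carries the divergence over from the diagonal. *)
Require Import Defs.
From mathcomp Require Import all_boot all_order all_algebra.
From mathcomp Require Import finmap.
From mathcomp Require Import all_classical all_reals all_analysis.
From mathcomp Require Import measurable_realfun ring lra.
Import Order.TTheory GRing.Theory Num.Theory.
Import numFieldNormedType.Exports.

Local Open Scope classical_set_scope.
Local Open Scope ring_scope.

(* [Num.Theory.sum_real] would shadow it. *)
Local Notation sum_real := Defs.sum_real.

(** * Sums of real families and weighted l^2 spaces *)

Section RealSums.
Context {R : realType} {I : choiceType}.
Implicit Types (a c : I -> R) (S : {fset I}).

(** [esum] is a supremum over finite sets, so bounds on it can be checked on real finite sums. *)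
Lemma esum_le_fsetP a (M : R) : (forall i, 0 <= a i) ->
  (\esum_(i in [set: I]) (a i)%:E <= M%:E)%E <->
  forall S, \sum_(i <- S) a i <= M.
Proof.
move=> a0; split=> [H S|H].
  rewrite -lee_fin; apply: le_trans H; apply: esum_ge.
  exists [set` S]; first by split=> //; exact: finite_fset.
  by rewrite fsbig_finite ?set_fsetK ?sumEFin//; exact: finite_fset.
apply: ge_ereal_sup => _ [X [finX _] <-].
by rewrite fsbig_finite// sumEFin lee_fin.
Qed.

Lemma ler_sum_fsetS a S S' : (forall i, 0 <= a i) -> (S `<=` S')%fset ->
  \sum_(i <- S) a i <= \sum_(i <- S') a i.
Proof.
move=> a0 /fsubsetP SS'.
rewrite [leRHS](big_fsetID _ (fun i => i \in S)) /= -[leLHS]addr0 lerD ?sumr_ge0//.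
rewrite le_eqVlt; apply/orP; left; apply/eqP; apply: eq_fbigl => i.
by rewrite !inE/=; apply/idP/andP => [iS|[]//]; split=> //; exact: SS'.
Qed.

Lemma esum_lt_pinftyP a : (forall i, 0 <= a i) ->
  (\esum_(i in [set: I]) (a i)%:E < +oo)%E <->
  exists M, forall S, \sum_(i <- S) a i <= M.
Proof.
move=> a0; split=> [H|[M HM]].
  exists (fine (\esum_(i in [set: I]) (a i)%:E)%E); apply/esum_le_fsetP => //.
  by rewrite fineK// ge0_fin_numE// esum_ge0// => i _; rewrite lee_fin.
by apply: le_lt_trans (ltry M); apply/esum_le_fsetP.
Qed.

(** Unconditional summation: convergence along the net of finite subsets ordered by inclusion.
    Unlike the separate positive and negative parts in [sum_real], it visibly respects linear
    combinations. *)
Definition sums_to a (l : R) := forall e, 0 < e ->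
  exists S0, forall S, (S0 `<=` S)%fset -> `|\sum_(i <- S) a i - l| < e.

Lemma sums_to_unique a l l' : sums_to a l -> sums_to a l' -> l = l'.
Proof.
move=> h h'; apply/eqP; rewrite -subr_eq0 -normr_le0; apply/ler_addgt0Pr => e e0.
have e2 : 0 < e / 2 by rewrite divr_gt0.
have [S HS] := h _ e2; have [S' HS'] := h' _ e2.
have := HS _ (fsubsetUl S S'); have := HS' _ (fsubsetUr S S').
set s := \sum_(_ <- _) _ => h1 h2.
rewrite add0r (_ : l - l' = (s - l') - (s - l)); last by ring.
by rewrite (le_trans (ler_normB _ _))// [e]splitr ltW// ltrD.
Qed.

Lemma sums_to_lin a c k l l' : sums_to a l -> sums_to c l' ->
  sums_to (fun i => k * a i + c i) (k * l + l').
Proof.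
move=> h h' e e0.
have k0 : 0 < `|k| + 1 by rewrite ltr_wpDl.
have [S HS] := h (e / 2 / (`|k| + 1)) (divr_gt0 (divr_gt0 e0 (ltr0n _ 2)) k0).
have [S' HS'] := h' _ (divr_gt0 e0 (ltr0n _ 2)).
exists (S `|` S')%fset => S1; rewrite fsubUset => /andP[/HS h1 /HS' h2].
rewrite big_split/= -mulr_sumr opprD addrACA -mulrBr.
rewrite (le_lt_trans (ler_normD _ _))// [e]splitr ler_ltD// normrM.
rewrite (@le_trans _ _ ((`|k| + 1) * (e / 2 / (`|k| + 1))))//.
  by rewrite ler_pM// ?lerDl// ltW.
by rewrite mulrC divfK// gt_eqF.
Qed.

Lemma nneg_sums_to a : (forall i, 0 <= a i) ->
  (\esum_(i in [set: I]) (a i)%:E < +oo)%E ->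
  sums_to a (fine (\esum_(i in [set: I]) (a i)%:E)%E).
Proof.
move=> a0 afin; set l := fine _.
have lE : (\esum_(i in [set: I]) (a i)%:E)%E = l%:E.
  by rewrite fineK// ge0_fin_numE// esum_ge0// => i _; rewrite lee_fin.
have lub S : \sum_(i <- S) a i <= l.
  by move: S; apply/esum_le_fsetP => //; rewrite lE.
move=> e e0; have [S HS] : exists S, l - e < \sum_(i <- S) a i.
  apply: contrapT => /forallNP H.
  have : (\esum_(i in [set: I]) (a i)%:E <= (l - e)%:E)%E.
    by apply/esum_le_fsetP => // S; rewrite leNgt; apply/negP; exact: H.
  by rewrite lE lee_fin; lra.
exists S => S' SS'; have := ler_sum_fsetS _ _ _ a0 SS'; have := lub S'.
by move=> ? ?; rewrite ler0_norm; lra.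
Qed.

Definition abs_summable a := exists M, forall S, \sum_(i <- S) `|a i| <= M.

(** The positive and negative parts are dominated by [|a i|], hence sum unconditionally, and their
    difference is [a]. Linearity of [sum_real] then follows from uniqueness of the limit. *)
Lemma sums_to_sum_real a : abs_summable a -> sums_to a (sum_real a).
Proof.
move=> [M HM].
have fin_part (c : I -> R) : (forall i, 0 <= c i <= `|a i|) ->
    sums_to c (fine (\esum_(i in [set: I]) (c i)%:E)%E).
  move=> ca; apply: nneg_sums_to => [i|]; first by have /andP[] := ca i.
  apply/esum_lt_pinftyP => [i|]; first by have /andP[] := ca i.
  exists M => S; apply: le_trans (HM S).
  by apply: ler_sum => i _; have /andP[] := ca i.
have := sums_to_lin _ _ (-1) _ _ (fin_part (fun i => Num.max (- a i) 0) _)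
  (fin_part (fun i => Num.max (a i) 0) _).
rewrite mulN1r addrC => H e e0.
have [||S HS] := H _ _ e e0; try by
  move=> i; rewrite le_max lexx orbT ge_max normr_ge0 andbT/= ?ler_norm// -normrN ler_norm.
exists S => S' /HS; congr (`| _ - _| < e); apply: eq_bigr => i _.
by case: (leP 0 (a i)) => ai; rewrite /Order.max/=; do ?case: ifP; lra.
Qed.

Lemma sum_realE a l : abs_summable a -> sums_to a l -> sum_real a = l.
Proof. by move=> /sums_to_sum_real; exact: sums_to_unique. Qed.

Lemma sum_real_nneg a : (forall i, 0 <= a i) ->
  sum_real a = fine (\esum_(i in [set: I]) (a i)%:E)%E.
Proof.
move=> a0; rewrite /sum_real [X in _ - fine X]esum1 ?subr0; last first.
  by move=> i _; rewrite max_r// oppr_le0.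
by congr fine; apply: eq_esum => i _; rewrite max_l.
Qed.

Lemma abs_summable_lin a c k : abs_summable a -> abs_summable c ->
  abs_summable (fun i => k * a i + c i).
Proof.
move=> [M HM] [M' HM']; exists (`|k| * M + M') => S.
apply: (@le_trans _ _ (\sum_(i <- S) (`|k| * `|a i| + `|c i|))).
  by apply: ler_sum => i _; rewrite (le_trans (ler_normD _ _))// normrM.
by rewrite big_split/= -mulr_sumr lerD// ler_wpM2l.
Qed.

Lemma sum_real_lin a c k : abs_summable a -> abs_summable c ->
  sum_real (fun i => k * a i + c i) = k * sum_real a + sum_real c.
Proof.
move=> ha hc; apply: sum_realE; first exact: abs_summable_lin.
by apply: sums_to_lin; exact: sums_to_sum_real.
Qed.

Lemma sum_fset_supp a S S' : (forall i, i \notin S -> a i = 0) ->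
  (S `<=` S')%fset -> \sum_(i <- S') a i = \sum_(i <- S) a i.
Proof.
move=> aS /fsubsetP SS'; rewrite (big_fsetID _ (fun i => i \in S))/=.
rewrite [X in _ + X]big1_fset ?addr0; last first.
  by move=> i; rewrite !inE/= => /andP[_ /aS].
by apply: eq_fbigl => i; rewrite !inE/=; apply/andP/idP => [[]//|iS]; split => //; exact: SS'.
Qed.

Lemma sums_to_supp a S : (forall i, i \notin S -> a i = 0) ->
  sums_to a (\sum_(i <- S) a i).
Proof.
by move=> aS e e0; exists S => S' SS'; rewrite (sum_fset_supp _ _ _ aS SS') subrr normr0.
Qed.

Lemma abs_summable_supp a S : (forall i, i \notin S -> a i = 0) -> abs_summable a.
Proof.
move=> aS; exists (\sum_(i <- S) `|a i|) => S'.
have aS' i : i \notin S -> `|a i| = 0 by move/aS ->; rewrite normr0.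
rewrite -(sum_fset_supp _ _ _ aS' (fsubsetUl S S')).
by apply: ler_sum_fsetS => //; exact: fsubsetUr.
Qed.

Lemma sum_real_supp a S : (forall i, i \notin S -> a i = 0) ->
  sum_real a = \sum_(i <- S) a i.
Proof.
by move=> aS; apply: sum_realE; [exact: abs_summable_supp aS|exact: sums_to_supp].
Qed.

Lemma sums_to_scale a k l : sums_to a l -> sums_to (fun i => k * a i) (k * l).
Proof.
move=> h; have h0 : sums_to (fun _ : I => 0) (0 : R).
  by move=> e e0; exists fset0 => S _; rewrite big1// subrr normr0.
have := sums_to_lin _ _ k _ _ h h0; rewrite addr0.
by congr sums_to; apply/funext => i; rewrite addr0.
Qed.

Lemma esum_sums_to a l : (forall i, 0 <= a i) -> sums_to a l ->
  (\esum_(i in [set: I]) (a i)%:E = l%:E)%E.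
Proof.
move=> a0 h; have le_l : (\esum_(i in [set: I]) (a i)%:E <= l%:E)%E.
  apply/esum_le_fsetP => // S; rewrite leNgt; apply/negP => lS.
  have [S' /(_ _ (fsubsetUr S S'))] := h (\sum_(i <- S) a i - l) ltac:(by rewrite subr_gt0).
  have := ler_sum_fsetS a S (S `|` S')%fset a0 (fsubsetUl _ _).
  by move=> h1; rewrite ger0_norm; lra.
have fin : (\esum_(i in [set: I]) (a i)%:E < +oo)%E := le_lt_trans le_l (ltry l).
rewrite (sums_to_unique _ _ _ h (nneg_sums_to _ a0 fin)) fineK//.
by rewrite ge0_fin_numE// esum_ge0// => i _; rewrite lee_fin.
Qed.

Lemma esum_supp a S : (forall i, 0 <= a i) -> (forall i, i \notin S -> a i = 0) ->
  (\esum_(i in [set: I]) (a i)%:E = (\sum_(i <- S) a i)%:E)%E.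
Proof. by move=> a0 aS; apply: esum_sums_to => //; exact: sums_to_supp. Qed.

End RealSums.

Lemma esum_setX (R : realType) (I J : choiceType) (a : I * J -> \bar R) :
  (forall p, 0 <= a p)%E ->
  (\esum_(p in [set: I * J]) a p =
   \esum_(i in [set: I]) \esum_(j in [set: J]) a (i, j))%E.
Proof.
move=> a0; rewrite (@esum_esum _ _ _ [set: I] (fun=> [set: J]) (fun i j => a (i, j)))//.
rewrite (_ : [set: I] `*`` _ = [set: I * J]); last by apply/seteqP; split.
by apply: eq_esum => -[].
Qed.

(** For [k > 0] finite sums give one inequality; the other is the same inequality for the factor
    [k^-1] and the family [k * a]. *)
Lemma esumZl (R : realType) (I : choiceType) (k : R) (a : I -> \bar R) :
  0 <= k -> (forall i, 0 <= a i)%E ->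
  (\esum_(i in [set: I]) (k%:E * a i) = k%:E * \esum_(i in [set: I]) a i)%E.
Proof.
rewrite le_eqVlt => /predU1P[<-|k0] a0.
  by rewrite mul0e esum1// => i _; rewrite mul0e.
have le k' (a' : I -> \bar R) : 0 < k' -> (forall i, 0 <= a' i)%E ->
    (\esum_(i in [set: I]) (k'%:E * a' i) <= k'%:E * \esum_(i in [set: I]) a' i)%E.
  move=> k'0 a'0; apply: ge_ereal_sup => _ [S [finS _] <-].
  rewrite fsbig_finite//= -ge0_sume_distrr//.
  apply: lee_wpmul2l; first by rewrite lee_fin ltW.
  apply: esum_ge; exists S => //.
  by rewrite fsbig_finite.
apply/eqP; rewrite eq_le le//=.
have kV : (k%:E * k^-1%:E = 1)%E by rewrite -EFinM mulfV// gt_eqF.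
rewrite -[leRHS]mul1e -kV.
rewrite -muleA; apply: lee_wpmul2l; first by rewrite lee_fin ltW.
have k_ge0 : (0 <= k%:E)%E by rewrite lee_fin ltW.
have := le k^-1 (fun i => k%:E * a i)%E.
rewrite invr_gt0 k0 => /(_ isT) /(_ (fun i => mule_ge0 k_ge0 (a0 i))).
apply: le_trans; apply: le_esum => i _.
by rewrite muleA -EFinM mulVf ?mul1e// gt_eqF.
Qed.

(** A nonnegative quadratic polynomial has nonpositive discriminant. For [A > 0] it is evaluated at
    its minimum [- B / A]; the other signs of [A] are contradictory or force [B = 0]. *)
Lemma discriminant_le (R : realFieldType) (A B C : R) :
  (forall k, 0 <= k ^+ 2 * A + 2 * k * B + C) -> B ^+ 2 <= A * C.
Proof.
move=> H; have C0 : 0 <= C by have := H 0; rewrite expr0n/= mulr0 !mul0r !add0r.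
have [A0|A0|A0] := ltrgtP A 0.
(* The evaluation point is [k + 1], where [k * A = -(1 + 2|B| + C)]: the quadratic term then
   outweighs the other two. *)
- have := H ((1 + `|B| * 2 + C) / - A + 1).
  set k := (_ / _); have k0 : 0 <= k.
    by rewrite divr_ge0// ?oppr_ge0 ?(ltW A0)// !addr_ge0// mulr_ge0.
  have kA : k * A = - (1 + `|B| * 2 + C).
    by rewrite /k invrN mulrN mulNr divfK// lt_eqF.
  move=> Hk; exfalso; move: Hk; apply/negP; rewrite -ltNge.
  have BB : B <= `|B| := ler_norm B.
  have : 2 * (k + 1) * B <= 2 * (k + 1) * `|B| by rewrite ler_wpM2l//; lra.
  rewrite (_ : (k + 1) ^+ 2 * A = (k + 1) * (k * A + A)); last by ring.
  by rewrite kA; nra.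
- have := H (- B / A); rewrite expr_div_n sqrrN.
  rewrite (_ : _ + C = C - B ^+ 2 / A); last by field; rewrite gt_eqF.
  by rewrite subr_ge0 ler_pdivrMr// mulrC.
- move: H; rewrite A0 mul0r => H.
  have [->|B0] := eqVneq B 0; first by rewrite expr0n.
  (* The linear polynomial takes the value -1 here. *)
  have := H (- (C + 1) / (2 * B)); rewrite mulr0 add0r.
  have -> : 2 * (- (C + 1) / (2 * B)) * B + C = -1 by field.
  by rewrite ler0N1.
Qed.

(** * Weighted l^2 spaces, used for [m] on vertices and for [b] on pairs of vertices *)

Section WeightedL2.
Context {R : realType} {V : countType} {m : V -> R}.
Hypothesis m_ge0 : forall x, 0 <= m x.
Implicit Types (f g h : V -> R) (S : {fset V}).

Lemma sqw_ge0 f x : 0 <= f x ^+ 2 * m x.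
Proof. by rewrite mulr_ge0// sqr_ge0. Qed.

Lemma in_l2P f : in_l2 m f <-> exists M, forall S, \sum_(x <- S) f x ^+ 2 * m x <= M.
Proof. by apply: esum_lt_pinftyP => x; exact: sqw_ge0. Qed.

Lemma in_l2_summable f g : in_l2 m f -> in_l2 m g ->
  abs_summable (fun x => f x * g x * m x).
Proof.
move=> /in_l2P[M HM] /in_l2P[M' HM']; exists (M + M') => S.
apply: le_trans (lerD (HM S) (HM' S)); rewrite -big_split/=.
apply: ler_sum => x _; rewrite -mulrDl normrM (ger0_norm (m_ge0 x)).
rewrite ler_wpM2r// -(@real_normK _ (f x)) ?num_real// -(@real_normK _ (g x)) ?num_real//.
rewrite normrM; have := normr_ge0 (f x); have := normr_ge0 (g x).
set u := `|f x|; set v := `|g x|; have := sqr_ge0 (u - v).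
rewrite sqrrB; have : 0 <= u * v by rewrite mulr_ge0 ?normr_ge0.
by lra.
Qed.

Lemma in_l2_lin k f g : in_l2 m f -> in_l2 m g -> in_l2 m (fun x => k * f x + g x).
Proof.
move=> /in_l2P[M HM] /in_l2P[M' HM']; apply/in_l2P.
exists (2 * k ^+ 2 * M + 2 * M') => S.
apply: (@le_trans _ _ (2 * k ^+ 2 * (\sum_(x <- S) f x ^+ 2 * m x)
   + 2 * (\sum_(x <- S) g x ^+ 2 * m x))); last first.
  by rewrite lerD// ler_wpM2l// mulr_ge0// sqr_ge0.
rewrite !mulr_sumr -big_split/=; apply: ler_sum => x _.
rewrite !mulrA -mulrDl ler_wpM2r// -subr_ge0.
by rewrite [leRHS](_ : _ = (k * f x - g x) ^+ 2) ?sqr_ge0//; ring.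
Qed.

Lemma in_l20 : in_l2 m (fun=> 0).
Proof. by apply/in_l2P; exists 0 => S; rewrite big1// => x _; rewrite expr0n/= mul0r. Qed.

Lemma in_l2Z k f : in_l2 m f -> in_l2 m (fun x => k * f x).
Proof.
move=> hf; have := in_l2_lin k _ _ hf in_l20.
by congr in_l2; apply/funext => x; rewrite addr0.
Qed.

Lemma in_l2D f g : in_l2 m f -> in_l2 m g -> in_l2 m (fun x => f x + g x).
Proof.
move=> hf hg; have := in_l2_lin 1 _ _ hf hg.
by congr in_l2; apply/funext => x; rewrite mul1r.
Qed.

Lemma in_l2B f g : in_l2 m f -> in_l2 m g -> in_l2 m (f \- g).
Proof.
move=> hf hg; have := in_l2_lin (-1) _ _ hg hf.
by congr in_l2; apply/funext => x/=; rewrite mulN1r addrC.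
Qed.

Lemma in_l2_supp f S : (forall x, x \notin S -> f x = 0) -> in_l2 m f.
Proof.
move=> fS; apply/in_l2P.
have [|M HM] := @abs_summable_supp _ _ (fun x => f x ^+ 2 * m x) S.
  by move=> x /fS ->; rewrite expr0n mul0r.
exists M => S'; apply: le_trans (HM S').
by apply: ler_sum => x _; rewrite ler_norm.
Qed.

Lemma l2innerC f g : l2inner m f g = l2inner m g f.
Proof. by rewrite /l2inner; congr sum_real; apply/funext => x; rewrite (mulrC (f x)). Qed.

Lemma l2inner_linl k f g h : in_l2 m f -> in_l2 m g -> in_l2 m h ->
  l2inner m (fun x => k * f x + g x) h = k * l2inner m f h + l2inner m g h.
Proof.
move=> hf hg hh; rewrite /l2inner -sum_real_lin; do ?exact: in_l2_summable.
by congr sum_real; apply/funext => x; ring.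
Qed.

Lemma l2innerBl f g h : in_l2 m f -> in_l2 m g -> in_l2 m h ->
  l2inner m (f \- g) h = l2inner m f h - l2inner m g h.
Proof.
move=> hf hg hh; have -> : f \- g = fun x => -1 * g x + f x.
  by apply/funext => x/=; rewrite mulN1r addrC.
by rewrite l2inner_linl// mulN1r addrC.
Qed.

Lemma l2innerDl f g h : in_l2 m f -> in_l2 m g -> in_l2 m h ->
  l2inner m (fun x => f x + g x) h = l2inner m f h + l2inner m g h.
Proof.
move=> hf hg hh; rewrite -[l2inner m f h]mul1r -l2inner_linl//.
by congr (l2inner m _ h); apply/funext => x/=; rewrite mul1r.
Qed.

Lemma l2inner0l f : l2inner m (fun=> 0) f = 0.
Proof.
rewrite /l2inner (@sum_real_supp _ _ _ fset0) ?big_seq_fset0//.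
by move=> x _; rewrite !mul0r.
Qed.

Lemma l2innerZl k f h : in_l2 m f -> in_l2 m h ->
  l2inner m (fun x => k * f x) h = k * l2inner m f h.
Proof.
move=> hf hh; rewrite -[RHS]addr0 -(l2inner0l h) -l2inner_linl//; last exact: in_l20.
by congr (l2inner m _ h); apply/funext => x/=; rewrite addr0.
Qed.

Lemma l2innerBr f g h : in_l2 m f -> in_l2 m g -> in_l2 m h ->
  l2inner m h (f \- g) = l2inner m h f - l2inner m h g.
Proof. by move=> *; rewrite !(l2innerC h) l2innerBl. Qed.

Lemma l2innerZr k f h : in_l2 m f -> in_l2 m h ->
  l2inner m h (fun x => k * f x) = k * l2inner m h f.
Proof. by move=> *; rewrite !(l2innerC h) l2innerZl. Qed.

Lemma l2innerff f : l2inner m f f = fine (l2sum m f).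
Proof. by rewrite /l2inner sum_real_nneg// => x; rewrite -expr2 sqw_ge0. Qed.

Lemma l2inner_ge0 f : 0 <= l2inner m f f.
Proof.
by rewrite l2innerff fine_ge0// esum_ge0// => x _; rewrite lee_fin sqw_ge0.
Qed.

Lemma l2norm_sqr f : l2norm m f ^+ 2 = l2inner m f f.
Proof. by rewrite /l2norm -l2innerff sqr_sqrtr// l2inner_ge0. Qed.

Lemma l2norm_ge0 f : 0 <= l2norm m f. Proof. exact: sqrtr_ge0. Qed.

Lemma l2_Cauchy_Schwarz f g : in_l2 m f -> in_l2 m g ->
  l2inner m f g ^+ 2 <= l2inner m f f * l2inner m g g.
Proof.
move=> hf hg; apply: discriminant_le => k.
have hkf := in_l2_lin k _ _ hf hg.
have := l2inner_ge0 (fun x => k * f x + g x).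
rewrite l2inner_linl// !(l2innerC _ (fun x => k * f x + g x)) !l2inner_linl//.
by rewrite (l2innerC g f); lra.
Qed.

Lemma l2_Cauchy_Schwarz_norm f g : in_l2 m f -> in_l2 m g ->
  `|l2inner m f g| <= l2norm m f * l2norm m g.
Proof.
move=> hf hg; rewrite -(@ler_pXn2r _ 2)// ?nnegrE ?mulr_ge0 ?l2norm_ge0//.
by rewrite real_normK ?num_real// exprMn !l2norm_sqr l2_Cauchy_Schwarz.
Qed.

Lemma l2norm_triangle f g : in_l2 m f -> in_l2 m g ->
  l2norm m (fun x => f x + g x) <= l2norm m f + l2norm m g.
Proof.
move=> hf hg; rewrite -(@ler_pXn2r _ 2)// ?nnegrE ?addr_ge0 ?l2norm_ge0//.
rewrite sqrrD !l2norm_sqr l2innerDl//; last exact: in_l2D.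
rewrite !(l2innerC _ (fun x => f x + g x)) !l2innerDl//.
have := l2_Cauchy_Schwarz_norm _ _ hf hg; have := ler_norm (l2inner m f g).
by rewrite (l2innerC g f) -mulr_natr; lra.
Qed.

Lemma l2norm_fset f S : in_l2 m f -> \sum_(x <- S) f x ^+ 2 * m x <= l2norm m f ^+ 2.
Proof.
move=> hf; rewrite l2norm_sqr l2innerff; move: S.
apply/esum_le_fsetP => [x|]; first exact: sqw_ge0.
by rewrite fineK// ge0_fin_numE// esum_ge0// => x _; rewrite lee_fin sqw_ge0.
Qed.

(** Turns a uniform bound on finite partial sums into membership and a norm bound at once; the
    integral of an l^2-valued family is controlled in this way. *)
Lemma l2norm_le_fset f K : 0 <= K ->
  (forall S, \sum_(x <- S) f x ^+ 2 * m x <= K ^+ 2) -> in_l2 m f /\ l2norm m f <= K.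
Proof.
move=> K0 H; have hf : in_l2 m f by apply/in_l2P; exists (K ^+ 2).
split=> //; rewrite -(@ler_pXn2r _ 2)// ?nnegrE ?l2norm_ge0//.
rewrite l2norm_sqr l2innerff -lee_fin fineK; last first.
  by rewrite ge0_fin_numE// esum_ge0// => x _; rewrite lee_fin sqw_ge0.
by apply/esum_le_fsetP => // x; exact: sqw_ge0.
Qed.

Lemma l2inner_supp f g S : (forall x, x \notin S -> g x = 0) ->
  l2inner m f g = \sum_(x <- S) f x * g x * m x.
Proof. by move=> gS; apply: sum_real_supp => x /gS ->; rewrite mulr0 mul0r. Qed.

Definition trunc S f : V -> R := fun x => if x \in S then f x else 0.

Lemma trunc_supp S f x : x \notin S -> trunc S f x = 0.
Proof. by rewrite /trunc => /negbTE ->. Qed.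

(** The squared distance from [f] to its truncation is [<f, f> - <f, trunc S f>], a tail of the
    convergent sum of [f^2 m]. *)
Lemma l2norm_trunc f : in_l2 m f ->
  forall e, 0 < e -> exists S, l2norm m (f \- trunc S f) < e.
Proof.
move=> hf e e0.
have fin : (\esum_(x in [set: V]) (f x ^+ 2 * m x)%:E < +oo)%E by [].
have [S HS] := nneg_sums_to _ (sqw_ge0 f) fin _ (exprn_gt0 2 e0).
exists S; set g := trunc S f.
have hg : in_l2 m g by apply: (in_l2_supp _ S) => x; exact: trunc_supp.
rewrite -(@ltr_pXn2r _ 2)// ?nnegrE ?l2norm_ge0 ?(ltW e0)// l2norm_sqr.
have gg h : l2inner m h g = \sum_(x <- S) h x * f x * m x.
  rewrite (l2inner_supp _ _ S); last by move=> x; exact: trunc_supp.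
  by rewrite [LHS]big_seq [RHS]big_seq; apply: eq_bigr => x xS; rewrite /g /trunc xS.
have -> : l2inner m (f \- g) (f \- g) = l2inner m f f - l2inner m f g.
  rewrite (l2innerBl _ _ _ hf hg (in_l2B _ _ hf hg)).
  rewrite (l2innerBr _ _ _ hf hg hf) (l2innerBr _ _ _ hf hg hg).
  have -> : l2inner m g g = l2inner m g f.
    rewrite (l2innerC g f) !gg [LHS]big_seq [RHS]big_seq; apply: eq_bigr => x xS.
    by rewrite /g /trunc xS.
  by rewrite subrr subr0.
have := HS S (fsubset_refl _); rewrite l2innerff gg -normrN opprB.
apply: le_lt_trans; apply: le_trans (ler_norm _).
by apply: lerB => //; apply: ler_sum => x _; rewrite -expr2.
Qed.

End WeightedL2.

(** * The energy form *)

Lemma finitely_supportedP (R : realType) (V : countType) (u : V -> R) :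
  finitely_supported u <-> exists S : {fset V}, forall x, x \notin S -> u x = 0.
Proof.
split=> [fu|[S HS]].
  exists (fset_set [set x | u x != 0]) => x; rewrite in_fset_set// notin_setE/=.
  by move=> /negP; rewrite negbK => /eqP.
apply: (sub_finite_set _ (finite_fset S)) => x/= ux.
by apply/negPn/negP => /HS /eqP; exact/negP.
Qed.

(* The capacity of [z], the infimum of the energy of the finitely supported
   [phi] with [phi z = 1], is positive iff evaluation at [z] is bounded by a
   multiple of the energy. *)
Definition zero_capacity {R : realType} {V : countType} (b : V -> V -> R) (z : V) : Prop :=
  ~ exists C, forall phi : V -> R, finitely_supported phi ->
      phi z ^+ 2 <= C * energy_form b (fun=> 0) phi phi.

Section Energy.
Context {R : realType} {V : countType} {b : V -> V -> R}.
Hypothesis b_graph : weighted_graph b (fun=> 0).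
Implicit Types (u v phi h : V -> R) (S : {fset V}).

(** The energy is half the squared norm of [grad u] in the l^2 space over [V * V] with weight [b],
    so the l^2 lemmas carry over to it. *)
Definition edge_weight (p : V * V) : R := b p.1 p.2.
Definition grad u (p : V * V) : R := u p.1 - u p.2.

Local Notation dg := (deg b (fun=> 0)).
Local Notation Q := (energy_form b (fun=> 0)).
Local Notation w := edge_weight.

Lemma weight_ge0 x y : 0 <= b x y. Proof. by case: b_graph. Qed.
Lemma weight_sym x y : b x y = b y x. Proof. by case: b_graph. Qed.
Lemma edge_weight_ge0 p : 0 <= w p. Proof. exact: weight_ge0. Qed.

Lemma energyE u : energy b (fun=> 0) u = ((2^-1)%:E * l2sum w (grad u))%E.
Proof.
rewrite /energy [X in (_ + X)%E]esum1 ?adde0; last by move=> x _; rewrite mul0r.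
by congr (_ * _)%E; apply: eq_esum => p _; rewrite mulrC.
Qed.

Lemma finite_energyP u : finite_energy b (fun=> 0) u <-> in_l2 w (grad u).
Proof.
rewrite /finite_energy energyE /in_l2.
have : (0 <= l2sum w (grad u))%E.
  by apply: esum_ge0 => p _; rewrite lee_fin mulr_ge0 ?sqr_ge0 ?edge_weight_ge0.
case: (l2sum w (grad u)) => [r||] // _; first by rewrite -EFinM !ltry.
by rewrite gt0_muley ?lte_fin.
Qed.

Lemma energy_formE u v : Q u v = 2^-1 * l2inner w (grad u) (grad v).
Proof.
rewrite /energy_form [X in _ + X](@sum_real_supp _ _ _ fset0); last first.
  by move=> x _; rewrite !mul0r.
rewrite big_seq_fset0 addr0; congr (_ * _).
by rewrite /l2inner; congr sum_real; apply/funext => p; rewrite /grad /w; ring.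
Qed.

Lemma fine_energy u : fine (energy b (fun=> 0) u) = Q u u.
Proof.
rewrite energyE energy_formE l2innerff; last exact: edge_weight_ge0.
have : (0 <= l2sum w (grad u))%E.
  by apply: esum_ge0 => p _; rewrite lee_fin mulr_ge0 ?sqr_ge0 ?edge_weight_ge0.
case: (l2sum w (grad u)) => [r||] //= _.
(* For infinite energy both sides are 0, as [fine] sends [+oo] to 0. *)
by rewrite gt0_muley ?lte_fin//= mulr0.
Qed.

Lemma gradB u v : grad (u \- v) = grad u \- grad v.
Proof. by apply/funext => p; rewrite /grad/=; ring. Qed.

Lemma finite_energyB u v : finite_energy b (fun=> 0) u ->
  finite_energy b (fun=> 0) v -> finite_energy b (fun=> 0) (u \- v).
Proof. by rewrite !finite_energyP gradB => hu hv; apply: in_l2B => //; exact: edge_weight_ge0. Qed.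

Lemma energy_form_ge0 u : 0 <= Q u u.
Proof. by rewrite energy_formE mulr_ge0 ?invr_ge0// l2inner_ge0//; exact: edge_weight_ge0. Qed.

Lemma energy_Cauchy_Schwarz u v : finite_energy b (fun=> 0) u -> finite_energy b (fun=> 0) v ->
  Q u v ^+ 2 <= Q u u * Q v v.
Proof.
rewrite !finite_energyP => hu hv; rewrite !energy_formE.
have := l2_Cauchy_Schwarz edge_weight_ge0 _ _ hu hv.
set A := l2inner _ _ _; set B := l2inner _ _ _; set C := l2inner _ _ _ => H.
have -> : 2^-1 * B * (2^-1 * C) = 2^-1 ^+ 2 * (B * C) by ring.
by rewrite exprMn ler_wpM2l// sqr_ge0.
Qed.

Lemma sqrt_energyE u : Num.sqrt (Q u u) = Num.sqrt 2^-1 * l2norm w (grad u).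
Proof.
rewrite energy_formE -(l2norm_sqr edge_weight_ge0) sqrtrM ?invr_ge0// sqrtr_sqr ger0_norm//.
exact: l2norm_ge0.
Qed.

Lemma sqrt_energy_triangle u v : finite_energy b (fun=> 0) u ->
  finite_energy b (fun=> 0) v ->
  Num.sqrt (Q v v) <= Num.sqrt (Q u u) + Num.sqrt (Q (u \- v) (u \- v)).
Proof.
rewrite !finite_energyP => hu hv; rewrite !sqrt_energyE -mulrDr ler_wpM2l ?sqrtr_ge0//.
have hvu : in_l2 w (grad (v \- u)) by rewrite gradB; apply: in_l2B => //; exact: edge_weight_ge0.
have -> : l2norm w (grad (u \- v)) = l2norm w (grad (v \- u)).
  congr (Num.sqrt (fine _)); apply: eq_esum => p _; congr (_%:E * _%:E)%E => //.
  by rewrite /grad/=; ring.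
have := l2norm_triangle edge_weight_ge0 _ _ hu hvu.
by congr (_ <= _); congr l2norm; apply/funext => p; rewrite /grad/=; ring.
Qed.

Lemma energy_edge u x y : finite_energy b (fun=> 0) u ->
  b x y * (u x - u y) ^+ 2 <= 2 * Q u u.
Proof.
move=> /finite_energyP hu; rewrite energy_formE mulVKf// -(l2norm_sqr edge_weight_ge0).
have := l2norm_fset edge_weight_ge0 _ [fset (x, y)]%fset hu.
by rewrite big_seq_fset1 mulrC.
Qed.

Lemma deg_sums_to x : sums_to (b x) (dg x).
Proof.
rewrite /deg addr0; apply: nneg_sums_to => [y|]; first exact: weight_ge0.
by case: b_graph.
Qed.

Lemma deg_esum x : (\esum_(y in [set: V]) (b x y)%:E = (dg x)%:E)%E.
Proof. by apply: esum_sums_to; [exact: weight_ge0|exact: deg_sums_to]. Qed.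

Lemma sum_le_deg x S : \sum_(y <- S) b x y <= dg x.
Proof. by move: S; apply/esum_le_fsetP; [exact: weight_ge0|rewrite deg_esum]. Qed.

Lemma deg_ge0 x : 0 <= dg x.
Proof. by have := sum_le_deg x fset0; rewrite big_seq_fset0. Qed.

Lemma esum_fst_sqr phi S : (forall x, x \notin S -> phi x = 0) ->
  (\esum_(p in [set: V * V]) (phi p.1 ^+ 2 * w p)%:E =
   (\sum_(x <- S) phi x ^+ 2 * dg x)%:E)%E.
Proof.
move=> phiS; rewrite esum_setX/=; last first.
  by move=> p; rewrite lee_fin mulr_ge0 ?sqr_ge0 ?edge_weight_ge0.
rewrite -(esum_supp (fun x => phi x ^+ 2 * dg x)); last 2 first.
- by move=> x; rewrite mulr_ge0 ?sqr_ge0 ?deg_ge0.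
- by move=> x /phiS ->; rewrite expr0n mul0r.
apply: eq_esum => x _; apply: esum_sums_to => [y|].
  by rewrite mulr_ge0 ?sqr_ge0 ?weight_ge0.
exact/sums_to_scale/deg_sums_to.
Qed.

Lemma esum_snd_sqr phi S : (forall x, x \notin S -> phi x = 0) ->
  (\esum_(p in [set: V * V]) (phi p.2 ^+ 2 * w p)%:E =
   (\sum_(x <- S) phi x ^+ 2 * dg x)%:E)%E.
Proof.
move=> phiS; rewrite -(esum_fst_sqr _ _ phiS).
rewrite (reindex_esum [set: V * V] [set: V * V] (fun p => (p.2, p.1))); last first.
  split=> //=; first by move=> [? ?] [? ?] _ _ [-> ->].
  by move=> [x y] _; exists (y, x).
by apply: eq_esum => p _/=; rewrite /w weight_sym.
Qed.

(** Expansion of the square: [phi p.1] and [phi p.2] both lie in the l^2 space over pairs. Their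
    squared norms agree by symmetry, and [dg] already collects the edges leaving [S]; the mixed term
    lives on [S * S]. *)
Lemma energy_supp phi S : (forall x, x \notin S -> phi x = 0) ->
  finite_energy b (fun=> 0) phi /\
  Q phi phi = \sum_(x <- S) phi x ^+ 2 * dg x -
              \sum_(x <- S) \sum_(y <- S) b x y * (phi x * phi y).
Proof.
move=> phiS.
have ge0 (f : V * V -> R) p : 0 <= f p ^+ 2 * w p by rewrite mulr_ge0 ?sqr_ge0 ?edge_weight_ge0.
have L1 : in_l2 w (fun p => phi p.1) by rewrite /in_l2 /l2sum (esum_fst_sqr _ _ phiS) ltry.
have L2 : in_l2 w (fun p => phi p.2) by rewrite /in_l2 /l2sum (esum_snd_sqr _ _ phiS) ltry.
have gE : grad phi = (fun p => phi p.1) \- (fun p => phi p.2) by [].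
split; first by apply/finite_energyP; rewrite gE; apply: in_l2B => //; exact: edge_weight_ge0.
have L12 := in_l2B edge_weight_ge0 _ _ L1 L2.
rewrite energy_formE gE (l2innerBl edge_weight_ge0)// !(l2innerBr edge_weight_ge0)//.
rewrite !(l2innerff edge_weight_ge0) {1 2}/l2sum (esum_fst_sqr _ _ phiS) (esum_snd_sqr _ _ phiS)/=.
rewrite (l2innerC (fun p => phi p.2)).
have -> : l2inner w (fun p => phi p.1) (fun p => phi p.2) =
    \sum_(x <- S) \sum_(y <- S) b x y * (phi x * phi y).
  rewrite /l2inner (@sum_real_supp _ _ _ (S `*` S)%fset); last first.
    move=> [x y]; rewrite in_fsetM/= negb_and => /orP[] /phiS ->;
    by rewrite ?mulr0 !mul0r.
  transitivity (\sum_(p <- [seq (x, y) | x <- S, y <- S]) b p.1 p.2 * (phi p.1 * phi p.2)).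
    rewrite (perm_big [seq (x, y) | x <- S, y <- S])/=.
      by apply: eq_bigr => p _; rewrite /w mulrC.
    apply: uniq_perm; first exact: fset_uniq.
      by apply: allpairs_uniq; rewrite ?fset_uniq// => -[? ?] [? ?].
    move=> [x y]; rewrite in_fsetM/=; apply/andP/allpairsP => [[xS yS]|[[? ?] [? ? [-> ->]]]//].
    by exists (x, y).
  by rewrite big_allpairs.
by field.
Qed.

(* Ground state transform: each cross term [phi x * phi y] is split by AM-GM
   with weights [h y / h x] and [h x / h y]. *)
Lemma hardy h k phi x0 : (forall x, 0 < h x) -> (forall x, 0 <= k x) ->
  (forall x S, \sum_(y <- S) b x y * h y <= dg x * h x - k x) ->
  finitely_supported phi -> phi x0 ^+ 2 * (k x0 / h x0) <= Q phi phi.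
Proof.
move=> h0 k0 hsup /finitely_supportedP[S phiS].
have [_ ->] := energy_supp _ _ phiS.
pose A := \sum_(x <- S) \sum_(y <- S) b x y * (phi x ^+ 2 * (h y / h x)).
have cross : \sum_(x <- S) \sum_(y <- S) b x y * (phi x * phi y) <= A.
  (* Exchanging the two sums and using the symmetry of [b] gives a second form of [A]; the average
     of both forms dominates the cross terms. *)
  have A' : A = \sum_(x <- S) \sum_(y <- S) b x y * (phi y ^+ 2 * (h x / h y)).
    rewrite /A exchange_big/=; apply: eq_bigr => x _; apply: eq_bigr => y _.
    by rewrite weight_sym.
  rewrite -(@ler_pM2l _ 2)// [leRHS]mulrDl mul1r {2}A' /A -big_split/= mulr_sumr.
  apply: ler_sum => x _; rewrite -big_split/= mulr_sumr; apply: ler_sum => y _.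
  rewrite -mulrDr mulrCA ler_wpM2l ?weight_ge0// -subr_ge0.
  have hx := h0 x; have hy := h0 y.
  rewrite [leRHS](_ : _ = (phi x * h y - phi y * h x) ^+ 2 / (h x * h y)).
    by rewrite divr_ge0 ?sqr_ge0 ?mulr_ge0 ?ltW.
  by field; rewrite !gt_eqF.
(* The superharmonicity hypothesis enters here, multiplied by [phi x ^+ 2 / h x]. *)
have diag : A <= \sum_(x <- S) phi x ^+ 2 * dg x - \sum_(x <- S) phi x ^+ 2 * (k x / h x).
  rewrite -sumrB; apply: ler_sum => x _.
  have -> : \sum_(y <- S) b x y * (phi x ^+ 2 * (h y / h x)) =
      phi x ^+ 2 / h x * \sum_(y <- S) b x y * h y.
    by rewrite mulr_sumr; apply: eq_bigr => y _; ring.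
  rewrite [leRHS](_ : _ = phi x ^+ 2 / h x * (dg x * h x - k x)); last first.
    by field; rewrite gt_eqF.
  apply: ler_wpM2l; last exact: hsup.
  by rewrite divr_ge0 ?sqr_ge0// (ltW (h0 x)).
have x0S : phi x0 ^+ 2 * (k x0 / h x0) <= \sum_(x <- S) phi x ^+ 2 * (k x / h x).
  have ge0 x : 0 <= phi x ^+ 2 * (k x / h x).
    by rewrite mulr_ge0 ?sqr_ge0// divr_ge0// (ltW (h0 x)).
  have [xS|xS] := boolP (x0 \in S); last first.
    by rewrite phiS// expr0n mul0r sumr_ge0.
  by rewrite (big_fsetD1 x0)//= lerDl sumr_ge0.
lra.
Qed.

(* The probability of going from [y] to [x] in [n] steps while staying in [K]. *)
Fixpoint killed (K : {fset V}) x n y : R :=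
  if n is n'.+1 then
    (y \in K)%:R * \sum_(z <- K) b y z / dg y * killed K x n' z
  else (y == x)%:R.

Lemma killed_ge0 K x n y : 0 <= killed K x n y.
Proof.
elim: n y => [|n IH] y /=; first exact: ler0n.
by rewrite mulr_ge0// sumr_ge0// => z _; rewrite mulr_ge0// divr_ge0 ?weight_ge0 ?deg_ge0.
Qed.

(** The partial Green function [u] satisfies [dg u <= dg delta_x + b u] on [K]. Multiplying by [u]
    and summing gives [Q u u <= dg x * u x], so the hypothesis yields [u x ^+ 2 <= C * dg x * u x].
    The bound depends on neither [K] nor [N]. *)
Lemma killed_green_bound K x C N : x \in K -> (forall y, 0 < dg y) ->
  (forall phi, finitely_supported phi -> phi x ^+ 2 <= C * Q phi phi) ->
  \sum_(n < N) killed K x n x <= C * dg x.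
Proof.
move=> xK dg_gt0 HC; set u := fun y => \sum_(n < N) killed K x n y.
(* Tested on the indicator of [x]: for negative [C] the right-hand side would be nonpositive, the
   left one is 1. *)
have C0 : 0 <= C.
  rewrite leNgt; apply/negP => C0.
  have fd : finitely_supported (fun y => (y == x)%:R : R).
    by apply/finitely_supportedP; exists [fset x]%fset => y; rewrite inE => /negbTE ->.
  have := HC _ fd; rewrite eqxx expr1n; apply/negP; rewrite -ltNge.
  by rewrite (@le_lt_trans _ _ 0)// nmulr_rle0// energy_form_ge0.
have u0 y : 0 <= u y by rewrite sumr_ge0// => n _; exact: killed_ge0.
have uK y : y \notin K -> u y = 0.
  move=> yK; rewrite /u big1// => -[[|n] _] _ /=; last by rewrite (negbTE yK) mul0r.
  by case: eqP yK => // ->; rewrite xK.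
(* Shifting the sum over [n < N] by one step adds the nonnegative term [n = N], whence an
   inequality. *)
have step y : y \in K -> dg y * u y <= dg y * (y == x)%:R + \sum_(z <- K) b y z * u z.
  move=> yK; have -> : \sum_(z <- K) b y z * u z = dg y * \sum_(n < N) killed K x n.+1 y.
    rewrite mulr_sumr; under eq_bigr do rewrite mulr_sumr.
    rewrite exchange_big/=; apply: eq_bigr => n _; rewrite yK mul1r mulr_sumr.
    by apply: eq_bigr => z _; field; rewrite gt_eqF.
  rewrite -mulrDr ler_wpM2l ?(ltW (dg_gt0 y))//.
  rewrite (_ : _ + _ = \sum_(n < N.+1) killed K x n y); last by rewrite big_ord_recl.
  by rewrite big_ord_recr/= -/(u y) lerDl killed_ge0.
have Qu : Q u u <= dg x * u x.
  have [_ ->] := energy_supp _ _ uK; rewrite -sumrB.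
  apply: (@le_trans _ _ (\sum_(y <- K) u y * (dg y * (y == x)%:R))).
    rewrite [leLHS]big_seq [leRHS]big_seq; apply: ler_sum => y yK.
    have -> : \sum_(z <- K) b y z * (u y * u z) = u y * \sum_(z <- K) b y z * u z.
      by rewrite mulr_sumr; apply: eq_bigr => z _; ring.
    rewrite expr2 -mulrA -mulrBr ler_wpM2l// lerBlDr mulrC step//.
  rewrite (big_fsetD1 x)//= eqxx mulr1 big1_fset ?addr0 1?mulrC// => y.
  by rewrite !inE => /andP[/negbTE -> _] _; rewrite !mulr0.
have fu : finitely_supported u by apply/finitely_supportedP; exists K.
have := HC u fu; have := ler_wpM2l C0 Qu; rewrite mulrA => h1 h2.
have : u x ^+ 2 <= C * dg x * u x by exact: le_trans h1.
rewrite expr2 -/(u x); have := u0 x; rewrite le_eqVlt => /predU1P[<- _|ux].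
  by rewrite mulr_ge0// (ltW (dg_gt0 x)).
by rewrite ler_pM2r.
Qed.

(** A positive superharmonic function is harmonic, up to any [k], at a vertex of zero capacity: a
    defect of at least [k] at [z] could be fed to [hardy] as a potential concentrated at [z],
    bounding [phi z ^+ 2] by [h z / k] times the energy. *)
Lemma harmonic_at_zero_capacity h z k : (forall x, 0 < h x) -> 0 < k ->
  (forall x S, \sum_(y <- S) b x y * h y <= dg x * h x) ->
  zero_capacity b z ->
  exists S, dg z * h z - k < \sum_(y <- S) b z y * h y.
Proof.
move=> h0 k0 hsup nocap; apply: contrapT => /forallNP H; apply: nocap.
exists (h z / k) => phi fphi.
pose kz x := k * (x == z)%:R.
have kzz : kz z = k by rewrite /kz eqxx mulr1.
have := hardy h kz phi z h0; rewrite kzz => H1.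
rewrite mulrC -ler_pdivrMr ?divr_gt0// invf_div; apply: H1 => //.
  by move=> x; rewrite mulr_ge0// ltW.
move=> x S; rewrite /kz; case: eqVneq => [->|_]; last by rewrite mulr0 subr0.
by rewrite mulr1 leNgt; exact/negP/H.
Qed.

(** Maximum principle: where the harmonic [h] attains its maximum 1, so do all neighbours, and
    connectedness spreads the value along paths. *)
Lemma superharmonic_max h y : (forall x, 0 < h x) -> (forall x, h x <= 1) ->
  (forall x S, \sum_(y <- S) b x y * h y <= dg x * h x) ->
  (forall z, zero_capacity b z) ->
  connected_graph b -> h y = 1 -> forall x, h x = 1.
Proof.
move=> h0 h1 hsup nocap conn hy x.
have edge z z' : 0 < b z z' -> h z = 1 -> h z' = 1.
  move=> bzz hz; apply/eqP; rewrite eq_le h1/= leNgt; apply/negP => hz'.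
  (* This is exactly the defect that the single neighbour [z'] would cause at [z]. *)
  have k0 : 0 < b z z' * (1 - h z') by rewrite mulr_gt0// subr_gt0.
  have [S HS] := harmonic_at_zero_capacity h z _ h0 k0 hsup (nocap z).
  move: HS; apply/negP; rewrite -leNgt hz mulr1.
  apply: (@le_trans _ _ (\sum_(y <- (z' |` S)%fset) b z y * h y)).
    apply: ler_sum_fsetS; last exact: fsubsetU1.
    by move=> u; rewrite mulr_ge0 ?weight_ge0 ?ltW.
  rewrite (big_fsetD1 z') ?fset1U1//=.
  have := sum_le_deg z (z' |` S)%fset; rewrite (big_fsetD1 z') ?fset1U1//=.
  have : \sum_(i <- ((z' |` S) `\ z')%fset) b z i * h i <=
      \sum_(i <- ((z' |` S) `\ z')%fset) b z i.
    by apply: ler_sum => u _; rewrite -[leRHS]mulr1 ler_wpM2l ?weight_ge0.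
  by rewrite mulrBr mulr1; lra.
have [s [+ <-]] := conn y x; elim: s y hy => [//|z s IH] y hy /= /andP[byz /IH]; apply.
exact: edge hy.
Qed.

(** An infinite [V] contains a second vertex, and a path to it leaves [x] through an edge of
    positive weight. *)
Lemma connected_deg_gt0 : infinite_set [set: V] -> connected_graph b ->
  forall x, 0 < dg x.
Proof.
move=> V_inf conn x.
have [y yx] : exists y, y <> x.
  apply: contrapT => /forallNP H; apply: V_inf.
  apply: (sub_finite_set _ (finite_set1 x)) => y _ /=; exact: contrapT (H y).
have [[|z s] [/=]] := conn x y; first by move=> _ xy; rewrite xy in yx.
move=> /andP[bxz _] _; apply: lt_le_trans bxz _.
by have := sum_le_deg x [fset z]%fset; rewrite big_seq_fset1.
Qed.

(** The difference is telescoped along a path, each edge controlling its own increment by the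
    energy. *)
Lemma connected_energy_bound : connected_graph b -> forall x y,
  exists2 C, 0 <= C & forall u, finite_energy b (fun=> 0) u ->
    (u x - u y) ^+ 2 <= C * Q u u.
Proof.
move=> conn x y; have [s [+ Hs]] := conn x y.
elim: s x Hs => [|z s IH] x /=.
  by move=> -> _; exists 0 => // u _; rewrite subrr expr0n mul0r.
move=> Hs /andP[bxz ps]; have [C C0 HC] := IH z Hs ps.
(* From [(p + q)^2 <= 2 p^2 + 2 q^2]: the first edge contributes [2 * (2 / b x z)], the rest of the
   path [2 * C]. *)
exists (4 / b x z + 2 * C) => [|u Eu]; first by rewrite addr_ge0 ?divr_ge0 ?mulr_ge0// ltW.
have h1 := HC u Eu; have h2 := energy_edge u x z Eu.
have h3 : (u x - u z) ^+ 2 <= 2 / b x z * Q u u.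
  by rewrite mulrAC ler_pdivlMr// mulrC.
apply: (@le_trans _ _ (2 * (u x - u z) ^+ 2 + 2 * (u z - u y) ^+ 2)).
  rewrite -subr_ge0 [leRHS](_ : _ = (u x - 2 * u z + u y) ^+ 2) ?sqr_ge0//.
  by ring.
have -> : (4 / b x z + 2 * C) * Q u u = 2 * (2 / b x z * Q u u) + 2 * (C * Q u u).
  by field; rewrite gt_eqF.
by lra.
Qed.

End Energy.

(** * Integrals of continuous functions *)

Section IntegralFromZero.
Context {R : realType}.
Implicit Types (g f : R -> R) (s t : R).
Local Notation mu := (@lebesgue_measure R).

Definition integ g s : R := \int[mu]_(t in `[0, s]) g t.

Lemma continuous_itv_integrable g a c : continuous g ->
  mu.-integrable `[a, c] (EFin \o g).
Proof.
move=> cg; apply: continuous_compact_integrable; first exact: segment_compact.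
exact: continuous_subspaceT.
Qed.

Lemma continuous_lin k f g : continuous f -> continuous g ->
  continuous (fun t => k * f t + g t).
Proof.
move=> cf cg t; apply: cvgD; last exact: cg.
by apply: cvgM; [exact: cvg_cst|exact: cf].
Qed.

Lemma integ_lin k f g s : continuous f -> continuous g ->
  integ (fun t => k * f t + g t) s = k * integ f s + integ g s.
Proof.
move=> cf cg; have ckf : continuous (fun t => k * f t).
  by move=> t; apply: cvgM; [exact: cvg_cst|exact: cf].
rewrite /integ RintegralD//; try exact: continuous_itv_integrable.
by rewrite RintegralZl//; exact: continuous_itv_integrable.
Qed.

Lemma integ_cst k s : 0 <= s -> integ (fun=> k) s = k * s.
Proof.
move=> s0; rewrite /integ Rintegral_cst//= lebesgue_measure_itv/= lte_fin.
by case: ltP => /= s0'; rewrite ?oppr0 ?addr0//; congr (_ * _); lra.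
Qed.

Lemma le_integ f g s : continuous f -> continuous g ->
  (forall t, 0 <= t <= s -> f t <= g t) -> integ f s <= integ g s.
Proof.
move=> cf cg fg; apply: le_Rintegral => //; exact: continuous_itv_integrable.
Qed.

Lemma eq_integ f g s : (forall t, 0 <= t <= s -> f t = g t) -> integ f s = integ g s.
Proof. by move=> fg; apply: eq_Rintegral => t; rewrite inE/= in_itv/=; exact: fg. Qed.

Lemma integ_sum (I : choiceType) (S : {fset I}) (c : I -> R) (g : I -> R -> R) s :
  (forall i, continuous (g i)) ->
  continuous (fun t => \sum_(i <- S) c i * g i t) /\
  integ (fun t => \sum_(i <- S) c i * g i t) s = \sum_(i <- S) c i * integ (g i) s.
Proof.
move=> cg; elim: (enum_fset S) => [|i r [IHc IHi]].
  split; first by under eq_fun do rewrite big_nil; exact: cst_continuous.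
  rewrite big_nil; under eq_integ do rewrite big_nil.
  by rewrite /integ Rintegral_cst//= mul0r.
have E : (fun t => \sum_(j <- i :: r) c j * g j t) =
  (fun t => c i * g i t + \sum_(j <- r) c j * g j t).
  by apply/funext => t; rewrite big_cons.
by rewrite E; split; [exact: continuous_lin|rewrite integ_lin// big_cons IHi].
Qed.

Lemma integ_bound g s M : continuous g -> 0 <= s ->
  (forall t, 0 <= t <= s -> `|g t| <= M) -> `|integ g s| <= M * s.
Proof.
move=> cg s0 gM; rewrite ler_norml -mulNr -!integ_cst//.
by apply/andP; split; apply: le_integ => //; try exact: cst_continuous;
  move=> t /gM; rewrite ler_norml => /andP[].
Qed.

Lemma integ_shift g s (h : R) : continuous g -> 0 <= s -> 0 <= h ->
  integ g (s + h) = integ g h + integ (fun t => g (t + h)) s.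
Proof.
move=> cg s0 h0.
have sub : integ (fun t => g (t + h)) s = \int[mu]_(t in `[h, s + h]) g t.
  have D : derive1 (fun t : R => t + h) = cst 1.
    by apply/funext => z; rewrite derive1E derive_val addr0.
  rewrite /integ /Rintegral; congr fine.
  have := @integration_by_substitution_increasing R (fun t => t + h) g 0 s s0.
  rewrite add0r => ->.
  - by apply: eq_integral => t _; rewrite fctE D/= mulr1.
  - by move=> x y _ _; rewrite ltrD2r.
  - by rewrite D => ? _; exact: cvg_cst.
  - by rewrite D; exact: is_cvg_cst.
  - by rewrite D; exact: is_cvg_cst.
  - have ch : continuous (fun t : R => t + h).
      by move=> t; apply: cvgD; [exact: cvg_id|exact: cvg_cst].
    split => //.
    + by apply: cvg_at_right_filter; exact: ch.
    + by apply: cvg_at_left_filter; exact: ch.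
  - exact: continuous_subspaceT.
(* The endpoint [h] is dropped because subtracting the integral over [[0, h]] leaves a half-open
   interval. *)
rewrite sub /integ -(@Rintegral_itv_obnd_cbnd R h (BRight (s + h))); last first.
  by apply: integrableS (continuous_itv_integrable g h (s + h) cg) => //;
    exact: subset_itv_oc_cc.
rewrite -(@Rintegral_itvB R g (BLeft 0) (BRight (s + h)) h) ?bnd_simp ?lerDr//.
  by rewrite [RHS]addrC subrK.
exact: continuous_itv_integrable.
Qed.

Lemma integ_EFin g s : continuous g ->
  (integ g s)%:E = (\int[mu]_(t in `[0%R, s]) (g t)%:E)%E.
Proof.
move=> cg; rewrite /integ /Rintegral fineK//.
by apply: integrable_fin_num => //; exact: continuous_itv_integrable.
Qed.

Lemma measurable_EFin_cont g (D : set R) : continuous g ->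
  measurable D -> measurable_fun D (EFin \o g).
Proof.
move=> cg mD; apply/measurable_EFinP; apply: measurable_funTS.
exact: continuous_measurable_fun.
Qed.

(** Monotone convergence along the intervals [[0, n]]. *)
Lemma integral_itvcy_le g C : continuous g -> (forall t, 0 <= t -> 0 <= g t) ->
  (forall s, 0 <= s -> integ g s <= C) ->
  (\int[mu]_(t in `[0%R, +oo[) (g t)%:E <= C%:E)%E.
Proof.
move=> cg g0 gC.
have -> : `[0%R, +oo[%classic = \bigcup_n `[0, n%:R : R]%classic.
  apply/seteqP; split=> [t|t [n _]]/=; rewrite !in_itv/= ?andbT; last by case/andP.
  move=> t0; exists (Num.truncn t).+1 => //=; rewrite in_itv/= t0 ltW//.
  exact: truncnS_gt.
have ndF : nondecreasing_seq (fun n => `[0, n%:R : R]%classic).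
  move=> m n mn; apply/subsetPset => t/=; rewrite !in_itv/= => /andP[-> /le_trans]; apply.
  by rewrite ler_nat.
have cvgF : (\int[mu]_(t in `[0%R, n%:R]) (g t)%:E)%E @[n --> \oo] -->
    (\int[mu]_(t in \bigcup_n `[0%R, n%:R]%classic) (g t)%:E)%E.
  apply: ge0_nondecreasing_set_cvg_integral => //=.
  - by move=> n; exact: measurable_EFin_cont.
  - by move=> n x; rewrite /= in_itv/= lee_fin => /andP[/g0].
rewrite -(cvg_lim _ cvgF)//; apply: lime_le.
  by apply/cvg_ex; eexists; exact: cvgF.
by apply: nearW => n; rewrite -integ_EFin// lee_fin gC.
Qed.

(** [f] may change sign, so both parts are estimated. Its negative part lies below [D] and has
    finite integral; its positive part plus [D] dominates [A] and has infinite integral. *)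
Lemma integral_itvcy_pinfty f (A D : R -> R) C : continuous f -> continuous A -> continuous D ->
  (forall t, 0 <= t -> [/\ 0 <= A t, 0 <= D t & A t - D t <= f t]) ->
  (forall s, 0 <= s -> integ D s <= C) ->
  (forall M, exists2 s, 0 <= s & M < integ A s) ->
  (\int[mu]_(t in `[0%R, +oo[) (f t)%:E = +oo)%E.
Proof.
move=> cf cA cD ADf DC AM.
have int_D : (\int[mu]_(t in `[0%R, +oo[) (D t)%:E <= C%:E)%E.
  by apply: integral_itvcy_le => // t /ADf[].
have int_A : (\int[mu]_(t in `[0%R, +oo[) (A t)%:E = +oo)%E.
  apply: eq_infty => M; have [s s0 /ltW Ms] := AM M.
  rewrite (@le_trans _ _ (integ A s)%:E) ?lee_fin// integ_EFin//.
  apply: ge0_subset_integral => //.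
  - exact: measurable_EFin_cont.
  - by move=> t; rewrite /= in_itv/= lee_fin andbT => /ADf[].
  - by move=> t; rewrite /= !in_itv/= andbT => /andP[].
have mf : measurable_fun (`[0, +oo[ : set R) (EFin \o f) by exact: measurable_EFin_cont.
have neg_le : (\int[mu]_(t in `[0%R, +oo[) ((EFin \o f)^\- t) <= C%:E)%E.
  apply: le_trans int_D; apply: ge0_le_integral => //.
  - exact: measurable_funeneg.
  - exact: measurable_EFin_cont.
  - move=> t; rewrite /= in_itv/= andbT => /ADf[A0 D0 h].
    by rewrite funenegE/= ge_max !lee_fin D0 andbT; lra.
rewrite integralE/=.
have -> : (\int[mu]_(t in `[0%R, +oo[) ((EFin \o f)^\+ t) = +oo)%E.
  have : (\int[mu]_(t in `[0%R, +oo[) (A t)%:E <=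
    \int[mu]_(t in `[0%R, +oo[) ((EFin \o f)^\+ t) +
    \int[mu]_(t in `[0%R, +oo[) (D t)%:E)%E.
    rewrite -ge0_integralD//=; last 3 first.
    - exact: measurable_funepos.
    - by move=> t; rewrite /= in_itv/= lee_fin andbT => /ADf[].
    - exact: measurable_EFin_cont.
    apply: ge0_le_integral => //=.
    - by move=> t; rewrite /= in_itv/= lee_fin andbT => /ADf[].
    - exact: measurable_EFin_cont.
    - by apply: emeasurable_funD; [exact: measurable_funepos|exact: measurable_EFin_cont].
    - move=> t; rewrite /= in_itv/= andbT => /ADf[A0 D0 h].
      rewrite funeposE/= -EFin_max -EFinD lee_fin -lerBlDr le_max.
      by apply/orP; left; lra.
  rewrite int_A leye_eq => /eqP; move: int_D.
  case: (\int[mu]_(t in `[0%R, +oo[) (D t)%:E)%E => [r||]//= _;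
  by case: (\int[mu]_(t in `[0%R, +oo[) ((EFin \o f)^\+ t))%E.
move: neg_le; case: (\int[mu]_(t in `[0%R, +oo[) ((EFin \o f)^\- t))%E => [r||]//=.
Qed.

End IntegralFromZero.

(** * The semigroup *)

Section L2Integral.
Context {R : realType} {V : countType} {m : V -> R}.
Hypothesis m_gt0 : forall x, 0 < m x.
Let m_ge0 x : 0 <= m x := ltW (m_gt0 x).

Lemma delta_supp (x y : V) : y \notin [fset x]%fset -> delta x y = 0 :> R.
Proof. by rewrite inE /delta => /negbTE ->. Qed.

Lemma in_l2_delta (x : V) : in_l2 m (delta x).
Proof. by apply: (in_l2_supp m_ge0 _ [fset x]%fset) => y; exact: delta_supp. Qed.

Lemma l2inner_delta (g : V -> R) x : l2inner m g (delta x) = g x * m x.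
Proof.
rewrite (l2inner_supp _ _ [fset x]%fset) ?big_seq_fset1 /delta ?eqxx ?mulr1//.
by move=> y; exact: delta_supp.
Qed.

(** * Integration over [[0, s]] of a bounded family in l^2, defined pointwise *)

Section Family.
Variables (F : R -> V -> R) (s M : R).
Hypothesis s_ge0 : 0 <= s.
Hypothesis F_l2 : forall t, in_l2 m (F t).
Hypothesis F_cont : forall x, continuous (fun t => F t x).
Hypothesis F_bound : forall t, 0 <= t <= s -> l2norm m (F t) <= M.

Let W x := integ (fun t => F t x) s.

Let M_ge0 : 0 <= M.
Proof. by apply: le_trans (F_bound 0 _); rewrite ?l2norm_ge0// lexx. Qed.

Let fin_supp_pairing g (S : {fset V}) : (forall x, x \notin S -> g x = 0) ->
  continuous (fun t => l2inner m (F t) g) /\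
  l2inner m W g = integ (fun t => l2inner m (F t) g) s.
Proof.
move=> gS.
have E t : l2inner m (F t) g = \sum_(x <- S) (g x * m x) * F t x.
  by rewrite (l2inner_supp _ _ _ gS); apply: eq_bigr => x _; ring.
have [c1 c2] := integ_sum V S (fun x => g x * m x) (fun x t => F t x) s F_cont.
under eq_fun do rewrite E.
split => //; rewrite c2 (l2inner_supp _ _ _ gS).
by apply: eq_bigr => x _; rewrite /W; ring.
Qed.

Lemma integ_pairing_le g : in_l2 m g -> continuous (fun t => l2inner m (F t) g) ->
  `|integ (fun t => l2inner m (F t) g) s| <= M * l2norm m g * s.
Proof.
move=> hg cg; apply: integ_bound => // t ts.
apply: le_trans (l2_Cauchy_Schwarz_norm m_ge0 _ _ (F_l2 t) hg) _.
by rewrite ler_wpM2r ?l2norm_ge0// F_bound.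
Qed.

(** Minkowski's inequality by duality: for the truncation [g] of [W] to a finite set,
    [|g|^2 = <W, g>] is the integral of [<F t, g>], hence at most [M * s * |g|]. *)
Lemma l2_integ : in_l2 m W /\ l2norm m W <= M * s.
Proof.
apply: (l2norm_le_fset m_ge0); first exact: mulr_ge0.
move=> S; set g := trunc S W.
have gS x : x \notin S -> g x = 0 by exact: trunc_supp.
have hg : in_l2 m g by exact: (in_l2_supp m_ge0 _ S).
have ggE : l2norm m g ^+ 2 = l2inner m W g.
  rewrite (l2norm_sqr m_ge0) !(l2inner_supp _ _ _ gS) [LHS]big_seq [RHS]big_seq.
  by apply: eq_bigr => x xS; rewrite /g /trunc xS.
have -> : \sum_(x <- S) W x ^+ 2 * m x = l2norm m g ^+ 2.
  rewrite ggE (l2inner_supp _ _ _ gS) [LHS]big_seq [RHS]big_seq.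
  by apply: eq_bigr => x xS; rewrite /g /trunc xS expr2.
have [cg Wg] := fin_supp_pairing _ _ gS.
have := integ_pairing_le g hg cg; rewrite -Wg -ggE.
have N0 := l2norm_ge0 (m := m) g; rewrite ger0_norm ?sqr_ge0// => H.
rewrite ler_pXn2r ?nnegrE ?mulr_ge0//.
have : l2norm m g * l2norm m g <= M * s * l2norm m g by move: H; rewrite expr2; lra.
move: N0; rewrite le_eqVlt => /predU1P[<- _|N0]; first exact: mulr_ge0.
by rewrite ler_pM2r.
Qed.

(** Exchange of pairing and integral. For finitely supported [g] it concerns a finite sum; in
    general [g] is truncated. *)
Lemma l2inner_integ g : in_l2 m g -> continuous (fun t => l2inner m (F t) g) ->
  l2inner m W g = integ (fun t => l2inner m (F t) g) s.
Proof.
move=> hg cg; have [hW WM] := l2_integ.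
apply/eqP; rewrite -subr_eq0 -normr_le0; apply/ler_addgt0Pr => e e0; rewrite add0r.
have Ms0 : 0 <= M * s by exact: mulr_ge0.
(* Both sides change by at most [M * s] times the truncation error, hence the factor 2; the [+ 1]
   keeps the denominator positive. *)
have [|S HS] := l2norm_trunc m_ge0 g hg (e / (2 * (M * s + 1))).
  by rewrite divr_gt0// mulr_gt0// ltr_wpDl.
set g' := trunc S g in HS.
have gS x : x \notin S -> g' x = 0 by exact: trunc_supp.
have hg' : in_l2 m g' by exact: (in_l2_supp m_ge0 _ S).
have [cg' Wg'] := fin_supp_pairing _ _ gS.
have hd := in_l2B m_ge0 _ _ hg hg'.
have dE t : l2inner m (F t) (g \- g') = -1 * l2inner m (F t) g' + l2inner m (F t) g.
  by rewrite (l2innerBr m_ge0)// mulN1r addrC.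
have cd : continuous (fun t => l2inner m (F t) (g \- g')).
  by under eq_fun do rewrite dE; exact: continuous_lin.
have -> : l2inner m W g - integ (fun t => l2inner m (F t) g) s =
  l2inner m W (g \- g') - integ (fun t => l2inner m (F t) (g \- g')) s.
  rewrite (eq_integ _ _ _ (fun t _ => dE t)) integ_lin// (l2innerBr m_ge0)// Wg'.
  by ring.
apply: le_trans (ler_normB _ _) _.
have h1 := integ_pairing_le _ hd cd.
have h2 := l2_Cauchy_Schwarz_norm m_ge0 _ _ hW hd.
have N0 := l2norm_ge0 (m := m) (g \- g').
have h3 : l2norm m W * l2norm m (g \- g') <= M * s * l2norm m (g \- g').
  by rewrite ler_wpM2r.
have h4 : (2 * (M * s + 1)) * l2norm m (g \- g') <= e.
  by rewrite mulrC -ler_pdivlMr ?ltW// mulr_gt0// ltr_wpDl.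
by move: h1 h2 h3 h4; lra.
Qed.

End Family.
End L2Integral.

(** * Continuity of orbits, the integrated orbit and its energy *)

Section Semigroup.
Context {R : realType} {V : countType} {b : V -> V -> R} {m : V -> R}.
Context {T : R -> (V -> R) -> (V -> R)}.
Hypothesis b_graph : weighted_graph b (fun=> 0).
Hypothesis m_gt0 : forall x, 0 < m x.
Hypothesis T_semigroup : semigroup_of m (op_LD b (fun=> 0) m) T.
Let m_ge0 x : 0 <= m x := ltW (m_gt0 x).
Implicit Types (f g : V -> R) (s t h : R).

Local Notation Q := (energy_form b (fun=> 0)).
Local Notation ip := (l2inner m).
Local Notation nrm := (l2norm m).

Lemma T_l2 t f : 0 <= t -> in_l2 m f -> in_l2 m (T t f).
Proof. exact: (semigroup_l2 T_semigroup). Qed.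

Lemma T_sub t f g : 0 <= t -> in_l2 m f -> in_l2 m g -> T t (f \- g) = T t f \- T t g.
Proof.
move=> t0 hf hg; have -> : f \- g = fun x => -1 * g x + f x.
  by apply/funext => x/=; rewrite mulN1r addrC.
rewrite (semigroup_linear T_semigroup)//.
by apply/funext => x/=; rewrite mulN1r addrC.
Qed.

Lemma T_scale t k f : 0 <= t -> in_l2 m f ->
  T t (fun x => k * f x) = fun x => k * T t f x.
Proof.
move=> t0 hf; have h0 := in_l20 m_ge0.
have T0 : T t (fun=> 0) = fun=> 0.
  have := T_sub t _ _ t0 h0 h0; rewrite (_ : (fun=> 0) \- (fun=> 0) = fun=> 0).
    by move=> ->; apply/funext => x /=; rewrite subrr.
  by apply/funext => x /=; rewrite subrr.
have := semigroup_linear T_semigroup k t0 hf h0; rewrite T0.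
rewrite (_ : (fun x => k * f x + 0) = fun x => k * f x).
  by move=> ->; apply/funext => x; rewrite addr0.
by apply/funext => x; rewrite addr0.
Qed.

Lemma l2norm_distC f g : nrm (f \- g) = nrm (g \- f).
Proof.
congr (Num.sqrt (fine _)); apply: eq_esum => x _; congr (_%:E)%E.
by rewrite /=; ring.
Qed.

(** For [r <= t] the difference is [T r (T (t - r) f - f)], and [T r] is a contraction. *)
Lemma T_dist t r f : 0 <= t -> 0 <= r -> in_l2 m f ->
  nrm (T t f \- T r f) <= nrm (T `|t - r| f \- f).
Proof.
wlog rt : t r / r <= t.
  move=> H t0 r0 hf; case: (leP r t) => [rt|/ltW tr]; first exact: H.
  by rewrite l2norm_distC distrC H.
move=> t0 r0 hf; have tr0 : 0 <= t - r by rewrite subr_ge0.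
rewrite ger0_norm//; have {1}-> : t = r + (t - r) by ring.
rewrite (semigroupD T_semigroup r0 tr0 hf).
rewrite -T_sub//; last exact: T_l2.
apply: (semigroup_contraction T_semigroup) => //.
by apply: (in_l2B m_ge0) => //; exact: T_l2.
Qed.

Lemma T_modulus f e : in_l2 m f -> 0 < e ->
  exists2 d, 0 < d & forall t, 0 <= t < d -> nrm (T t f \- f) < e.
Proof.
move=> hf e0; have := semigroup_continuous T_semigroup hf.
move=> /cvgrPdist_lt/(_ e e0) [d /= d0 Hd]; exists d => //.
move=> t /andP[]; rewrite le_eqVlt => /predU1P[<- _|t0 td].
  rewrite (semigroup0 T_semigroup)// /l2norm /l2sum esum1 ?sqrtr0//.
  by move=> x _; rewrite /= subrr expr0n mul0r.
have := Hd t; rewrite /ball_/= sub0r normrN gtr0_norm// => /(_ td t0).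
by rewrite sub0r normrN ger0_norm// l2norm_ge0.
Qed.

(** [T] is unconstrained at negative times; [|t|] extends the orbit to a function continuous on the
    whole line without changing integrals over [[0, s]]. *)
Lemma T_pairing_continuous f g : in_l2 m f -> in_l2 m g ->
  continuous (fun t => ip (T `|t| f) g).
Proof.
move=> hf hg t; apply/cvgrPdist_lt => e e0.
have [|d d0 Hd] := T_modulus f (e / (nrm g + 1)) hf.
  by rewrite divr_gt0// ltr_wpDl// l2norm_ge0.
near=> r.
have ht := T_l2 _ _ (normr_ge0 t) hf; have hr := T_l2 _ _ (normr_ge0 r) hf.
rewrite -(l2innerBl m_ge0)//.
apply: le_lt_trans (l2_Cauchy_Schwarz_norm m_ge0 _ _ (in_l2B m_ge0 _ _ ht hr) hg) _.
have : nrm (T `|t| f \- T `|r| f) < e / (nrm g + 1).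
  apply: le_lt_trans (T_dist _ _ _ (normr_ge0 _) (normr_ge0 _) hf) _.
  apply: Hd; rewrite normr_ge0/=; apply: le_lt_trans (ler_dist_dist _ _) _.
  by near: r; exact: cvgr_dist_lt.
have N0 := l2norm_ge0 (m := m) g; set n := nrm _ => nlt.
have n0 : 0 <= n by exact: l2norm_ge0.
have : n * (nrm g + 1) < e by rewrite -ltr_pdivlMr// ltr_wpDl.
by apply: le_lt_trans; rewrite ler_wpM2l// lerDl.
Unshelve. all: by end_near.
Qed.

Lemma T_coord_continuous f x : in_l2 m f -> continuous (fun t => T `|t| f x).
Proof.
(* Evaluation at [x] is the pairing with [delta x] divided by [m x]. Here and below, [+ 0] produces
   the shape [k * f + g] of the linearity lemmas. *)
move=> hf; have -> : (fun t => T `|t| f x) = (fun t => (m x)^-1 * ip (T `|t| f) (delta x) + 0).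
  by apply/funext => t; rewrite l2inner_delta addr0; field; rewrite gt_eqF.
apply: continuous_lin; last exact: cst_continuous.
by apply: T_pairing_continuous => //; exact: (in_l2_delta m_gt0).
Qed.

(** * The integrated orbit [U s f] and the action of the generator on it *)

Definition orbit_integ s f x := integ (fun t => T `|t| f x) s.
Local Notation U := orbit_integ.

Let T_bound f s : in_l2 m f -> forall t, 0 <= t <= s -> nrm (T `|t| f) <= nrm f.
Proof. by move=> hf t _; exact: (semigroup_contraction T_semigroup). Qed.

Let T_abs_l2 f : in_l2 m f -> forall t, in_l2 m (T `|t| f).
Proof. by move=> hf t; exact: T_l2. Qed.

Lemma orbit_integ_l2 s f : 0 <= s -> in_l2 m f -> in_l2 m (U s f).
Proof.
move=> s0 hf.
by have [] := l2_integ m_gt0 (fun t => T `|t| f) s _ s0 (T_abs_l2 f hf)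
  (fun x => T_coord_continuous f x hf) (T_bound f s hf).
Qed.

Lemma orbit_integ_pairing s f g : 0 <= s -> in_l2 m f -> in_l2 m g ->
  ip (U s f) g = integ (fun t => ip (T `|t| f) g) s.
Proof.
move=> s0 hf hg; apply: (l2inner_integ m_gt0 (fun t => T `|t| f) s (nrm f)) => //.
- exact: T_abs_l2.
- by move=> x; exact: T_coord_continuous.
- exact: T_bound.
- exact: T_pairing_continuous.
Qed.

(** Symmetry moves [T h] onto [delta x], the pairing passes under the integral, and symmetry moves
    it back to [f]: what remains is the integral of [T (t + h) f x] over [[0, s]]. *)
Lemma semigroup_orbit_integ s h f x : 0 <= s -> 0 <= h -> in_l2 m f ->
  T h (U s f) x = U (s + h) f x - U h f x.
Proof.
move=> s0 h0 hf; have hd := in_l2_delta m_gt0 x.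
apply: (@mulIf _ (m x)); first by rewrite gt_eqF.
rewrite -l2inner_delta (semigroup_symmetric T_semigroup)//; last exact: orbit_integ_l2.
rewrite orbit_integ_pairing//; last exact: T_l2.
have -> : U (s + h) f x - U h f x = integ (fun t => T `|t + h| f x) s.
  rewrite {1}/U integ_shift//; last exact: T_coord_continuous.
  by rewrite -/(U h f x); ring.
have c1 : continuous (fun t => T `|t + h| f x).
  move=> t; apply: (@continuous_comp _ _ _ (fun t => t + h) (fun t => T `|t| f x)).
    by apply: cvgD; [exact: cvg_id|exact: cvg_cst].
  exact: T_coord_continuous.
transitivity (integ (fun t => m x * T `|t + h| f x + 0) s).
  apply: eq_integ => t /andP[t0 _].
  rewrite -(semigroup_symmetric T_semigroup)//; last exact: T_l2.
  rewrite l2inner_delta -(semigroupD T_semigroup)// !ger0_norm ?addr_ge0//.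
  by rewrite (addrC h) addr0 mulrC.
by rewrite integ_lin//; [rewrite integ_cst// mul0r addr0 mulrC|exact: cst_continuous].
Qed.

(** The function is the mean over [[0, h]] of [T t f - f], so [l2_integ] applies to that family. *)
Lemma orbit_integ_average h f e : 0 < h -> in_l2 m f ->
  (forall t, 0 <= t <= h -> nrm (T t f \- f) <= e) ->
  nrm (fun x => h^-1 * U h f x - f x) <= e.
Proof.
move=> h0 hf He; have hge0 := ltW h0.
have cF x : continuous (fun t => T `|t| f x - f x).
  have -> : (fun t => T `|t| f x - f x) = (fun t => 1 * T `|t| f x + - f x).
    by apply/funext => t; rewrite mul1r.
  by apply: continuous_lin; [exact: T_coord_continuous|exact: cst_continuous].
have lF t : in_l2 m (T `|t| f \- f) by apply: (in_l2B m_ge0) => //; exact: T_l2.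
have bF t : 0 <= t <= h -> nrm (T `|t| f \- f) <= e.
  by move=> /andP[t0 th]; rewrite ger0_norm// He// t0.
have := l2_integ m_gt0 (fun t => T `|t| f \- f) h e hge0 lF cF bF.
have -> : (fun x => integ (fun t => (T `|t| f \- f) x) h) =
    (fun x => h * (h^-1 * U h f x - f x)).
  apply/funext => x.
  transitivity (integ (fun t => 1 * T `|t| f x + - f x) h).
    by apply: eq_integ => t _ /=; rewrite mul1r.
  rewrite integ_lin; [|exact: T_coord_continuous|exact: cst_continuous].
  by rewrite integ_cst// -/(U h f x); field; rewrite gt_eqF.
set D := fun x => h^-1 * U h f x - f x => -[hD nD].
have hD' : in_l2 m D.
  have := in_l2Z m_ge0 h^-1 _ hD; congr in_l2; apply/funext => x.
  by rewrite mulKf// gt_eqF.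
have : h * nrm D <= e * h.
  apply: le_trans nD; rewrite -(@ler_pXn2r _ 2)// ?nnegrE ?mulr_ge0 ?l2norm_ge0//.
  rewrite exprMn !(l2norm_sqr m_ge0) (l2innerZl m_ge0)// (l2innerZr m_ge0)//.
  by rewrite mulrA expr2.
by rewrite mulrC ler_pM2r.
Qed.

(** With [D = t^-1 U_t f - f], the difference quotient of [U_s f] minus [f - T_s f] is [D - T_s D],
    because [U_s f - T_t U_s f = U_t f - T_s U_t f]. Its norm is at most twice that of [D], which
    tends to 0. *)
Lemma generator_orbit_integ s f : 0 <= s -> in_l2 m f ->
  op_LD b (fun=> 0) m (U s f) (f \- T s f).
Proof.
move=> s0 hf; apply/(semigroup_generator T_semigroup); split.
- exact: orbit_integ_l2.
- by apply: (in_l2B m_ge0) => //; exact: T_l2.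
apply/cvgrPdist_le => e e0.
have [|d d0 Hd] := T_modulus f (e / 2) hf; first by rewrite divr_gt0.
near=> t; have t0 : 0 < t by [].
have td : t < d by near: t; exact: nbhs_right_lt.
rewrite sub0r normrN ger0_norm ?l2norm_ge0//.
pose D x := t^-1 * U t f x - f x.
have hD : in_l2 m D.
  apply: (in_l2B m_ge0 (fun x => t^-1 * U t f x)) => //.
  by apply: (in_l2Z m_ge0); apply: orbit_integ_l2 => //; exact: ltW.
have nD : nrm D <= e / 2.
  by apply: orbit_integ_average => // r /andP[r0 rt]; rewrite ltW// Hd// r0 (le_lt_trans rt).
have TD : T s D = fun x => t^-1 * T s (U t f) x - T s f x.
  rewrite /D (T_sub s (fun x => t^-1 * U t f x))//; last first.
    by apply: (in_l2Z m_ge0); apply: orbit_integ_l2 => //; exact: ltW.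
  by rewrite T_scale//; apply: orbit_integ_l2 => //; exact: ltW.
have -> : (fun x => t^-1 * (U s f x - T t (U s f) x) - (f \- T s f) x) =
    (fun x => D x + -1 * T s D x).
  apply/funext => x; rewrite TD /D /= !semigroup_orbit_integ ?(ltW t0)// addrC.
  by rewrite (addrC t s); ring.
have hTD := T_l2 s D s0 hD.
apply: le_trans (l2norm_triangle m_ge0 _ _ hD (in_l2Z m_ge0 (-1) _ hTD)) _.
have -> : nrm (fun x => -1 * T s D x) = nrm (T s D).
  by congr (Num.sqrt (fine _)); apply: eq_esum => x _; congr (_%:E)%E; ring.
have := semigroup_contraction T_semigroup s0 hD.
by move: nD; lra.
Unshelve. all: by end_near.
Qed.

Lemma dom_orbit_integ s f : 0 <= s -> in_l2 m f -> dom_QD b (fun=> 0) m (U s f).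
Proof. by move=> s0 hf; have [] := generator_orbit_integ s f s0 hf. Qed.

Lemma energy_orbit_integ s f v : 0 <= s -> in_l2 m f -> dom_QD b (fun=> 0) m v ->
  Q (U s f) v = ip f v - ip (T s f) v.
Proof.
move=> s0 hf hv; have [_ _ /(_ v hv) ->] := generator_orbit_integ s f s0 hf.
by rewrite (l2innerBl m_ge0)//; [exact: T_l2|case: hv].
Qed.

Lemma finitely_supported_dom phi : finitely_supported phi -> dom_QD b (fun=> 0) m phi.
Proof.
move=> fphi; have [S phiS] := (finitely_supportedP _ _ phi).1 fphi.
have [Ephi _] := energy_supp b_graph _ _ phiS.
have hphi := in_l2_supp m_ge0 _ _ phiS.
split => // e e0; exists phi => //.
have z : phi \- phi = fun=> 0 by apply/funext => x /=; rewrite subrr.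
rewrite z /Qnorm (fine_energy b_graph) -(l2innerff m_ge0) l2inner0l.
have -> : Q (fun=> 0) (fun=> 0) = 0.
  rewrite energy_formE (_ : grad (fun=> 0) = fun=> 0) ?l2inner0l ?mulr0//.
  by apply/funext => p; rewrite /grad subrr.
by rewrite addr0 sqrtr0.
Qed.

Lemma T_pairingD s t f : 0 <= s -> 0 <= t -> in_l2 m f ->
  ip (T s f) (T t f) = ip (T (t + s) f) f.
Proof.
move=> s0 t0 hf; rewrite (semigroupD T_semigroup)//.
by rewrite [RHS](semigroup_symmetric T_semigroup)//; exact: T_l2.
Qed.

(** Half of the time is moved to the other side by symmetry; positivity and monotonicity of
    [t -> <T t f, f>] follow. *)
Lemma T_pairing_sqr t f : 0 <= t -> in_l2 m f -> ip (T t f) f = nrm (T (t / 2) f) ^+ 2.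
Proof.
move=> t0 hf; rewrite (l2norm_sqr m_ge0) T_pairingD ?divr_ge0//.
by congr (ip (T _ f) f); field.
Qed.

Lemma T_pairing_ge0 t f : 0 <= t -> in_l2 m f -> 0 <= ip (T t f) f.
Proof. by move=> t0 hf; rewrite T_pairing_sqr// sqr_ge0. Qed.

Lemma T_pairing_anti r t f : 0 <= r <= t -> in_l2 m f -> ip (T t f) f <= ip (T r f) f.
Proof.
move=> /andP[r0 rt] hf; have t0 := le_trans r0 rt.
rewrite !T_pairing_sqr// ler_pXn2r ?nnegrE ?l2norm_ge0//.
have r2 : 0 <= r / 2 by rewrite divr_ge0.
have tr2 : 0 <= (t - r) / 2 by rewrite divr_ge0// subr_ge0.
have -> : t / 2 = (t - r) / 2 + r / 2 by field.
rewrite (semigroupD T_semigroup)//.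
by apply: (semigroup_contraction T_semigroup) => //; exact: T_l2.
Qed.

(** The function [I(s)]; for [s >= 0] and [f] in l^2 it is the pairing of [f] with [U s f]. *)
Definition pairing_integ f s := integ (fun t => ip (T `|t| f) f) s.

(** The energy is [<f, U_s f> - <T_s f, U_s f>], and the subtracted term is the integral of the
    nonnegative [<T (t + s) f, f>]. *)
Lemma energy_orbit_integ_le s f : 0 <= s -> in_l2 m f -> Q (U s f) (U s f) <= pairing_integ f s.
Proof.
move=> s0 hf; rewrite energy_orbit_integ//; last exact: dom_orbit_integ.
have hU := orbit_integ_l2 s f s0 hf.
rewrite l2innerC orbit_integ_pairing// [X in _ - X]l2innerC orbit_integ_pairing//; last exact: T_l2.
rewrite /pairing_integ gerBl -[leLHS](mul0r s) -integ_cst//; apply: le_integ.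
- exact: cst_continuous.
- by apply: T_pairing_continuous => //; exact: T_l2.
move=> t /andP[t0 _]; rewrite ger0_norm// T_pairingD//.
by apply: T_pairing_ge0 => //; rewrite addr_ge0.
Qed.

(** The hypothesis extends from finitely supported functions to [U s f] by density in the form norm.
    Together with the energy bound this gives [I(s)^2 <= C I(s)]. *)
Lemma pairing_integ_le C f s : 0 <= C -> in_l2 m f -> 0 <= s ->
  (forall phi, finitely_supported phi -> ip f phi ^+ 2 <= C * Q phi phi) ->
  pairing_integ f s <= C.
Proof.
move=> C0 hf s0 HC; have hU := orbit_integ_l2 s f s0 hf.
have [EU _ approx] := dom_orbit_integ s f s0 hf.
have AE : ip f (U s f) = pairing_integ f s by rewrite l2innerC orbit_integ_pairing.
have A0 : 0 <= pairing_integ f s.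
  by apply: le_trans (energy_orbit_integ_le s f s0 hf); exact: (energy_form_ge0 b_graph).
have AQ : pairing_integ f s <= Num.sqrt C * Num.sqrt (Q (U s f) (U s f)).
  apply/ler_addgt0Pr => e e0.
  have sC := sqrtr_ge0 C; have nf := l2norm_ge0 (m := m) f.
  have K0 : 0 < Num.sqrt C + nrm f + 1 by rewrite ltr_wpDl// addr_ge0.
  (* The energy error enters with factor [Num.sqrt C], the l^2 error with factor [nrm f]; the [+ 1]
     keeps the sum positive. *)
  have [|phi fphi] := approx (e / (Num.sqrt C + nrm f + 1)); first exact: divr_gt0.
  set eta := e / _ => Hphi; have eta0 : 0 < eta by exact: divr_gt0.
  have [Ephi hphi _] := finitely_supported_dom phi fphi.
  have hd := in_l2B m_ge0 _ _ hU hphi; have Ed := finite_energyB b_graph _ _ EU Ephi.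
  have Q0 := energy_form_ge0 b_graph (U s f \- phi).
  have L0 := l2inner_ge0 m_ge0 (U s f \- phi).
  rewrite /Qnorm (fine_energy b_graph) -(l2innerff m_ge0) in Hphi.
  have d1 : nrm (U s f \- phi) < eta.
    apply: le_lt_trans Hphi.
    by rewrite /l2norm -(l2innerff m_ge0) ler_sqrt ?lerDr// addr_ge0.
  have d2 : Num.sqrt (Q (U s f \- phi) (U s f \- phi)) < eta.
    by apply: le_lt_trans Hphi; rewrite ler_sqrt ?lerDl// addr_ge0.
  have d3 := sqrt_energy_triangle b_graph _ _ EU Ephi.
  have d4 : `|ip f phi| <= Num.sqrt C * Num.sqrt (Q phi phi).
    rewrite -sqrtrM// -[leLHS]sqrtr_sqr ler_sqrt ?mulr_ge0 ?energy_form_ge0//.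
    exact: HC.
  have d5 := l2_Cauchy_Schwarz_norm m_ge0 _ _ hf hd.
  have d6 : ip f (U s f) = ip f phi + ip f (U s f \- phi).
    by rewrite (l2innerBr m_ge0)//; ring.
  have d7 : Num.sqrt C * Num.sqrt (Q phi phi) <=
      Num.sqrt C * (Num.sqrt (Q (U s f) (U s f)) + eta).
    by rewrite ler_wpM2l//; lra.
  have d8 : nrm f * nrm (U s f \- phi) <= nrm f * eta by rewrite ler_wpM2l// ltW.
  have d9 : (Num.sqrt C + nrm f + 1) * eta = e by rewrite /eta mulrC divfK// gt_eqF.
  have := ler_norm (ip f phi); have := ler_norm (ip f (U s f \- phi)).
  by rewrite -AE d6; lra.
have : pairing_integ f s ^+ 2 <= C * pairing_integ f s.
  rewrite (@le_trans _ _ (C * Q (U s f) (U s f)))//; last first.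
    by rewrite ler_wpM2l// energy_orbit_integ_le.
  rewrite -[leRHS]sqr_sqrtr ?mulr_ge0 ?energy_form_ge0//.
  by rewrite ler_pXn2r ?nnegrE ?sqrtr_ge0// sqrtrM.
move: A0; rewrite le_eqVlt => /predU1P[<-//|A0]; rewrite expr2.
by rewrite ler_pM2r.
Qed.

(** Here [<f, phi> = Q (U_s f) phi + <T_s f, phi>]. Cauchy-Schwarz bounds the first term by
    [Num.sqrt (M * Q phi phi)] for every [s]; the second vanishes as [s] grows. *)
Lemma pairing_le_of_pairing_integ M f phi : in_l2 m f ->
  (forall s, 0 <= s -> pairing_integ f s <= M) ->
  finitely_supported phi -> ip f phi ^+ 2 <= M * Q phi phi.
Proof.
move=> hf HM fphi; have dphi := finitely_supported_dom phi fphi.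
have [Ephi hphi _] := dphi.
have ca : continuous (fun t => ip (T `|t| f) f) by exact: T_pairing_continuous.
have M0 : 0 <= M.
  apply: le_trans (HM 0 (lexx _)); apply: le_trans (energy_orbit_integ_le 0 f (lexx _) hf).
  exact: (energy_form_ge0 b_graph).
(* [|T_s f|^2] is the last, hence smallest, value on [[0, 2 s]] of the integrand of
   [I(2 s) <= M]. *)
have decay s : 0 < s -> nrm (T s f) ^+ 2 <= M / s.
  move=> s0; rewrite ler_pdivlMr//.
  have E : nrm (T s f) ^+ 2 = ip (T (2 * s) f) f.
    by rewrite T_pairing_sqr ?mulr_ge0 ?ltW//; congr (nrm (T _ f) ^+ 2); field.
  apply: le_trans (HM (2 * s) _); last by rewrite mulr_ge0 ?ltW.
  have s2 : 0 <= 2 * s by rewrite mulr_ge0 ?ltW.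
  apply: (@le_trans _ _ (integ (fun=> nrm (T s f) ^+ 2) (2 * s))).
    by rewrite integ_cst// ler_wpM2l ?sqr_ge0//; lra.
  apply: le_integ => //; first exact: cst_continuous.
  move=> t /andP[t0 ts]; rewrite ger0_norm// E; apply: T_pairing_anti => //.
  by rewrite t0.
have bound e : 0 < e -> `|ip f phi| <= Num.sqrt (M * Q phi phi) + e.
  move=> e0; have n0 := l2norm_ge0 (m := m) phi.
  pose eta := e / (nrm phi + 1).
  have eta0 : 0 < eta by rewrite divr_gt0// ltr_wpDl.
  (* Chosen so that [M / s <= eta ^+ 2], while [M + 1] makes [s] positive. *)
  pose s := (M + 1) / eta ^+ 2.
  have s0 : 0 < s by rewrite divr_gt0 ?exprn_gt0// ltr_wpDl.
  have hT := T_l2 s f (ltW s0) hf.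
  have nT : nrm (T s f) <= eta.
    rewrite -(@ler_pXn2r _ 2)// ?nnegrE ?l2norm_ge0 ?(ltW eta0)//.
    apply: le_trans (decay s s0) _; rewrite ler_pdivrMr// /s mulrC divfK ?lerDl//.
    by rewrite gt_eqF// exprn_gt0.
  have hEU := energy_orbit_integ s f phi (ltW s0) hf dphi.
  have [EU _ _] := dom_orbit_integ s f (ltW s0) hf.
  have c1 : `|Q (U s f) phi| <= Num.sqrt (M * Q phi phi).
    rewrite -[leLHS]sqrtr_sqr ler_sqrt ?mulr_ge0 ?energy_form_ge0//.
    apply: le_trans (energy_Cauchy_Schwarz b_graph _ _ EU Ephi) _.
    rewrite ler_wpM2r ?energy_form_ge0//.
    by apply: le_trans (energy_orbit_integ_le s f (ltW s0) hf) _; exact: HM (ltW s0).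
  have c2 := l2_Cauchy_Schwarz_norm m_ge0 _ _ hT hphi.
  have c3 : nrm (T s f) * nrm phi <= e.
    rewrite (@le_trans _ _ (eta * (nrm phi + 1)))//.
      by rewrite ler_pM ?l2norm_ge0// lerDl.
    by rewrite /eta divfK// gt_eqF// ltr_wpDl.
  have -> : ip f phi = Q (U s f) phi + ip (T s f) phi by rewrite hEU; ring.
  by apply: le_trans (ler_normD _ _) _; lra.
have : `|ip f phi| <= Num.sqrt (M * Q phi phi) by apply/ler_addgt0Pr.
rewrite -(@ler_pXn2r _ 2)// ?nnegrE ?sqrtr_ge0//.
by rewrite real_normK ?num_real// sqr_sqrtr// mulr_ge0// energy_form_ge0.
Qed.

End Semigroup.

(** * The random walk *)

Section CountableDecomposition.
Context {R : realType} {V : countType} {d : measure_display} {Omega : measurableType d}.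
Variable (P : {measure set Omega -> \bar R}).

(** Countable additivity over the fibres of [Y], enumerated by [pickle]; integers that encode no
    vertex contribute the empty set. *)
Lemma measure_esum_preimage (Y : Omega -> V) (B : set Omega) :
  (forall A, measurable (Y @^-1` A)) -> measurable B ->
  (P B = \esum_(z in [set: V]) P (B `&` Y @^-1` [set z]))%E.
Proof.
move=> mY mB; pose F (k : nat) := B `&` Y @^-1` [set z : V | choice.pickle z = k].
have mF k : measurable (F k) by exact: measurableI.
have BE : B = \bigcup_k F k.
  by apply/seteqP; split=> [w Bo|w [k _ []]//]; exists (choice.pickle (Y w)).
have tF : trivIset [set: nat] F.
  by move=> i j _ _ [w [[_ /= Hi] [_ /= Hj]]]; rewrite -Hi -Hj.
rewrite [LHS](_ : _ = \sum_(k <oo) P (F k))%E; last first.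
  by rewrite {1}BE measure_bigcup//; apply: eq_eseriesl => k; rewrite in_setT.
rewrite nneseries_esumT//.
have -> : (\esum_(i in [set: nat]) P (F i) =
    \esum_(i in choice.pickle @` [set: V]) P (F i))%E.
  rewrite [RHS]esum_mkcond; apply: eq_esum => i _; case: ifPn => //.
  rewrite notin_setE => Hi; rewrite (_ : F i = set0) ?measure0//.
  by apply/seteqP; split=> // w [_ /= H]; apply: Hi; exists (Y w).
rewrite (esum_image [set: V] choice.pickle (fun i => P (F i))); last first.
  by move=> u v _ _; exact: (pcan_inj choice.pickleK).
apply: eq_esum => z _; congr (P (_ `&` _)); apply/seteqP; split=> w /= H.
  exact: (pcan_inj choice.pickleK).
by rewrite H.
Qed.

End CountableDecomposition.

(** * Probabilities of path events of the walk *)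

Section Walk.
Context {R : realType} {V : countType} {b : V -> V -> R}.
Context {d : measure_display} {Omega : measurableType d} {P : probability Omega R}.
Context {X : nat -> Omega -> V}.
Hypothesis b_graph : weighted_graph b (fun=> 0).
Hypothesis X_walk : random_walk b P X.
Hypothesis deg_gt0 : forall x, 0 < deg b (fun=> 0) x.
Implicit Types (A : nat -> set V) (s : nat -> V) (n M : nat) (x y z : V).

Local Notation dg := (deg b (fun=> 0)).
Local Notation Q := (energy_form b (fun=> 0)).

Definition past n s := [set w | forall k, (k <= n)%N -> X k w = s k].
Definition future n A M := [set w | forall j, (j <= M)%N -> A j (X (n + j)%N w)].

(* [path_prob A M z] is the probability that the walk started at [z] lies in
   [A j] at each time [j <= M]. *)
Fixpoint path_prob A M z : \bar R :=
  ((z \in A 0%N)%:R%:E *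
   if M is M'.+1 then
     \esum_(z' in [set: V]) ((b z z' / dg z)%:E * path_prob (fun j => A j.+1) M' z')
   else 1)%E.

Lemma step_prob_ge0 z z' : 0 <= b z z' / dg z.
Proof. by rewrite divr_ge0 ?(weight_ge0 b_graph) ?(deg_ge0 b_graph). Qed.

Lemma path_prob_ge0 A M z : (0 <= path_prob A M z)%E.
Proof.
elim: M A z => [|M IH] A z /=; first by rewrite mule1 lee_fin.
rewrite mule_ge0 ?lee_fin// esum_ge0// => z' _.
by rewrite mule_ge0// lee_fin step_prob_ge0.
Qed.

Lemma measurable_past n s : measurable (past n s).
Proof.
rewrite (_ : past n s = \bigcap_(k in [set k | (k <= n)%N]) X k @^-1` [set s k]).
  by apply: bigcap_measurable => [|k _]; [exists 0%N|exact: (walk_measurable X_walk)].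
by apply/seteqP; split=> w.
Qed.

Lemma measurable_future n A M : measurable (future n A M).
Proof.
rewrite (_ : future n A M = \bigcap_(j in [set j | (j <= M)%N]) X (n + j)%N @^-1` A j).
  by apply: bigcap_measurable => [|k _]; [exists 0%N|exact: (walk_measurable X_walk)].
by apply/seteqP; split=> w.
Qed.

Lemma pastS n s : past n.+1 s = X n.+1 @^-1` [set s n.+1] `&` past n s.
Proof.
apply/seteqP; split=> [w H|w [H1 H2] k]/=.
  by split=> [|k kn]; apply: H => //; exact: leqW.
by rewrite leq_eqVlt ltnS => /predU1P[->|/H2].
Qed.

(** The Markov property in product form; it persists for a null history, both sides then being 0. *)
Lemma prob_pastS n s : P (past n.+1 s) = (P (past n s) * (b (s n) (s n.+1) / dg (s n))%:E)%E.
Proof.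
have mS : measurable (past n.+1 s) by exact: measurable_past.
have := measure_ge0 P (past n s); rewrite le_eqVlt => /predU1P[p0|p0].
  apply/eqP; rewrite -p0 mul0e eq_le measure_ge0 andbT p0.
  apply: le_measure; rewrite ?inE//; first exact: measurable_past.
  by rewrite pastS; exact: subIsetr.
have := walk_markov X_walk (s n.+1) p0; rewrite /cond_prob -pastS => H.
rewrite -H -[in RHS](fineK (fin_num_measure P _ (measurable_past n s))) -EFinM.
rewrite mulrC divfK; first by rewrite fineK// fin_num_measure.
rewrite gt_eqF//; apply: fine_gt0.
have pfin := fin_num_measure P _ (measurable_past n s).
by rewrite fineK// p0 ltey_eq pfin.
Qed.

(** Induction on [M]: the event is split according to [X n.+1], and that vertex is appended to the
    history. *)
Lemma prob_past_future n s A M :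
  P (past n s `&` future n A M) = (P (past n s) * path_prob A M (s n))%E.
Proof.
elim: M n s A => [|M IH] n s A /=.
  have [sA|sA] := boolP (s n \in A 0%N); rewrite /= ?mul1e ?mul0e ?mule1 ?mule0.
    congr (P _); apply/seteqP; split=> [w []//|w po]; split=> // j.
    by rewrite leqn0 => /eqP ->; rewrite addn0 po//; exact/set_mem.
  rewrite (_ : _ `&` _ = set0) ?measure0//; apply/seteqP; split=> // w [po /(_ 0%N isT)].
  by rewrite addn0 po// => h; move: sA; rewrite notin_setE.
have [sA|sA] := boolP (s n \in A 0%N); rewrite /= ?mul1e ?mul0e ?mule0; last first.
  rewrite (_ : _ `&` _ = set0) ?measure0//; apply/seteqP; split=> // w [po /(_ 0%N isT)].
  by rewrite addn0 po// => h; move: sA; rewrite notin_setE.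
have -> : past n s `&` future n A M.+1 = past n s `&` future n.+1 (fun j => A j.+1) M.
  apply/seteqP; split=> w [po fo]; split=> // j jM.
    by rewrite addSnnS; apply: fo.
  case: j jM => [_|j jM]; first by rewrite addn0 po//; exact/set_mem.
  by rewrite -addSnnS; exact: fo.
rewrite (measure_esum_preimage P (X n.+1)); last 2 first.
- exact: (walk_measurable X_walk).
- by apply: measurableI; [exact: measurable_past|exact: measurable_future].
have pfin := fin_num_measure P _ (measurable_past n s).
rewrite -(fineK pfin) -esumZl; last 2 first.
- by rewrite fine_ge0.
- by move=> z; rewrite mule_ge0 ?path_prob_ge0// lee_fin step_prob_ge0.
(* The history [s] overwritten by [z] at time [n.+1]. *)
apply: eq_esum => z _; pose s' k := if k == n.+1 then z else s k.
have s'z : s' n.+1 = z by rewrite /s' eqxx.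
have s's k : (k <= n)%N -> s' k = s k by rewrite /s'; case: eqP => // ->; rewrite ltnn.
have past_s' : past n s' = past n s.
  by apply/seteqP; split=> w po k kn; rewrite po// s's.
transitivity (P (past n.+1 s' `&` future n.+1 (fun j => A j.+1) M)).
  congr (P _); rewrite pastS s'z past_s' setIAC; congr (_ `&` _).
  exact: setIC.
by rewrite IH prob_pastS past_s' s'z s's// -muleA fineK.
Qed.

Lemma path_prob_le1 A M z : (path_prob A M z <= 1)%E.
Proof.
elim: M A z => [|M IH] A z /=; first by rewrite mule1 lee_fin; case: (z \in _).
case: (z \in _); rewrite ?mul0e ?mul1e ?lee_fin//.
apply: (@le_trans _ _ (\esum_(z' in [set: V]) (b z z' / dg z)%:E)%E).
  by apply: le_esum => z' _; rewrite -[leRHS]mule1 lee_wpmul2l ?lee_fin ?step_prob_ge0.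
rewrite (esum_sums_to _ 1) ?lee_fin//; first by move=> z'; exact: step_prob_ge0.
have := sums_to_scale _ (dg z)^-1 _ (deg_sums_to b_graph z).
by rewrite mulVf ?gt_eqF//; congr sums_to; apply/funext => z'; rewrite mulrC.
Qed.

Lemma path_prob_anti A M z : (path_prob A M.+1 z <= path_prob A M z)%E.
Proof.
elim: M A z => [|M IH] A z; last first.
  rewrite /= -/(path_prob _ _ _); apply: lee_wpmul2l; first by rewrite lee_fin.
  apply: le_esum => z' _; apply: lee_wpmul2l; first by rewrite lee_fin step_prob_ge0.
  exact: IH.
apply: lee_wpmul2l; first by rewrite lee_fin.
(* The total transition mass is recovered as a path probability whose initial set is all of [V]. *)
have := path_prob_le1 (fun j => if j is j'.+1 then A j'.+1 else setT) 1 z.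
by rewrite [X in (X <= _)%E]/= in_setT mul1e.
Qed.

(** * Hitting probabilities of a vertex *)

Definition avoid y M z : R := fine (path_prob (fun=> [set~ y]) M z).

Lemma avoidE y M z : path_prob (fun=> [set~ y]) M z = (avoid y M z)%:E.
Proof.
rewrite fineK// ge0_fin_numE ?path_prob_ge0//.
exact: le_lt_trans (path_prob_le1 _ _ _) (ltry 1).
Qed.

Lemma avoid_ge0 y M z : 0 <= avoid y M z.
Proof. by rewrite -lee_fin -avoidE path_prob_ge0. Qed.

Lemma avoid_le1 y M z : avoid y M z <= 1.
Proof. by rewrite -lee_fin -avoidE path_prob_le1. Qed.

Lemma avoid_self y M : avoid y M y = 0.
Proof.
have yN : (y \in [set~ y]%classic) = false by rewrite memNset//= => /(_ erefl).
by rewrite /avoid; case: M => [|M] /=; rewrite yN /= ?mul0e ?mul0r.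
Qed.

Lemma avoid_anti y z : nonincreasing_seq (avoid y ^~ z).
Proof.
by apply/nonincreasing_seqP => M; rewrite -lee_fin -!avoidE path_prob_anti.
Qed.

Lemma avoid_cvg y z : avoid y M z @[M --> \oo] --> limn (avoid y ^~ z).
Proof.
apply: nonincreasing_is_cvgn; first exact: avoid_anti.
by exists 0 => _ [M _ <-]; exact: avoid_ge0.
Qed.

(** The probability that the walk from [z] ever visits [y], time 0 included. *)
Definition hit y z : R := 1 - limn (avoid y ^~ z).

(** One-step analysis: [dg z] splits into the weighted sums of [avoid] and [1 - avoid], and the
    first is at least [dg z * avoid y M.+1 z], even at [z = y] where the latter is 0. *)
Lemma avoid_step y M z (S : {fset V}) :
  \sum_(x <- S) b z x * (1 - avoid y M x) <= dg z * (1 - avoid y M.+1 z).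
Proof.
have b0 := weight_ge0 b_graph.
have S_le (a : V -> R) c : (forall x, 0 <= a x) ->
  (\esum_(x in [set: V]) (b z x * a x)%:E = c%:E)%E -> \sum_(x <- S) b z x * a x <= c.
  move=> a0 H; move: S; apply/esum_le_fsetP => [x|]; first by rewrite mulr_ge0.
  by rewrite H.
have split_deg : ((dg z)%:E = \esum_(x in [set: V]) (b z x * avoid y M x)%:E +
    \esum_(x in [set: V]) (b z x * (1 - avoid y M x))%:E)%E.
  rewrite -esumD; last 2 first.
  - by move=> x _; rewrite lee_fin mulr_ge0// avoid_ge0.
  - by move=> x _; rewrite lee_fin mulr_ge0// subr_ge0 avoid_le1.
  rewrite -(deg_esum b_graph z); apply: eq_esum => x _.
  by rewrite -EFinD; congr (_%:E); ring.
have le_step : ((dg z * avoid y M.+1 z)%:E <=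
    \esum_(x in [set: V]) (b z x * avoid y M x)%:E)%E.
  rewrite EFinM -avoidE /=; set c := (_%:R)%R.
  apply: (@le_trans _ _ ((dg z)%:E * \esum_(z' in [set: V])
      ((b z z' / dg z)%:E * path_prob (fun=> [set~ y]) M z'))%E).
    apply: lee_wpmul2l; first by rewrite lee_fin (deg_ge0 b_graph).
    rewrite -[leRHS]mul1e; apply: lee_wpmul2r; last by rewrite lee_fin /c; case: (z \in _).
    apply: esum_ge0 => z' _; rewrite mule_ge0 ?path_prob_ge0// lee_fin.
    exact: step_prob_ge0.
  rewrite -esumZl; last 2 first.
  - exact: (deg_ge0 b_graph).
  - move=> z'; rewrite mule_ge0 ?path_prob_ge0// lee_fin; exact: step_prob_ge0.
  apply: le_esum => x _; rewrite avoidE -!EFinM lee_fin le_eqVlt; apply/orP; left.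
  by apply/eqP; field; rewrite gt_eqF.
have : (\esum_(x in [set: V]) (b z x * (1 - avoid y M x))%:E <=
    (dg z * (1 - avoid y M.+1 z))%:E)%E.
  move: split_deg le_step.
  have : (0 <= \esum_(x in [set: V]) (b z x * (1 - avoid y M x))%:E)%E.
    by apply: esum_ge0 => x _; rewrite lee_fin mulr_ge0// subr_ge0 avoid_le1.
  case: (\esum_(x in _) (b z x * (1 - _))%:E)%E => [r||]//;
  case: (\esum_(x in _) (b z x * _)%:E)%E => [r'||]// _ [->].
  by rewrite !lee_fin; lra.
move=> H; move: S {S_le}; apply/esum_le_fsetP => // x.
by rewrite mulr_ge0// subr_ge0 avoid_le1.
Qed.

Lemma hit_superharmonic y z (S : {fset V}) : \sum_(x <- S) b z x * hit y x <= dg z * hit y z.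
Proof.
have cvgS : \sum_(x <- S) b z x * (1 - avoid y M x) @[M --> \oo] -->
    \sum_(x <- S) b z x * hit y x.
  apply: cvg_big => [|x _]; first exact: add_continuous.
  apply: cvgM; first exact: cvg_cst.
  by apply: cvgB; [exact: cvg_cst|exact: avoid_cvg].
rewrite -(cvg_lim _ cvgS)//; apply: limr_le; first by apply/cvg_ex; eexists; exact: cvgS.
apply: nearW => M; apply: le_trans (avoid_step y M z S) _.
rewrite ler_wpM2l ?(deg_ge0 b_graph)// lerB//.
by apply: nonincreasing_cvgn_ge; [exact: avoid_anti|exact: avoid_cvg].
Qed.

Lemma hit_self y : hit y y = 1.
Proof.
rewrite /hit (_ : avoid y ^~ y = fun=> 0) ?lim_cst ?subr0//.
by apply/funext => M; exact: avoid_self.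
Qed.

Lemma hit_le1 y z : hit y z <= 1.
Proof.
rewrite /hit gerBl; apply: limr_ge; first exact: avoid_cvg.
by apply: nearW => M; exact: avoid_ge0.
Qed.

Lemma hit_gt0 y z : connected_graph b -> 0 < hit y z.
Proof.
move=> conn; have [s [+ Hs]] := conn z y.
elim: s z Hs => [|x s IH] z /=; first by move=> ->; rewrite hit_self.
move=> Hs /andP[bzx ps]; have hx := IH x Hs ps.
have := hit_superharmonic y z [fset x]%fset; rewrite big_seq_fset1 => H.
by rewrite -(pmulr_rgt0 _ (deg_gt0 z)); apply: lt_le_trans H; rewrite mulr_gt0.
Qed.

(** The maximum principle gives [hit y = 1] everywhere. After any history the walk then avoids [y]
    forever with probability 0, and there are countably many times [N] from which avoidance could
    begin. *)
Lemma recurrent_of_zero_capacity : connected_graph b ->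
  (forall z, zero_capacity b z) ->
  recurrent_walk P X.
Proof.
move=> conn nocap x y.
have hit1 z : hit y z = 1.
  apply: (superharmonic_max b_graph (hit y) y) => //.
  - by move=> u; exact: hit_gt0.
  - exact: hit_le1.
  - exact: hit_superharmonic.
  - exact: hit_self.
have avoid0 z : avoid y M z @[M --> \oo] --> (0 : R).
  have -> : 0 = limn (avoid y ^~ z) by have := hit1 z; rewrite /hit; lra.
  exact: avoid_cvg.
pose av N := [set w | forall n, (N <= n)%N -> X n w <> y].
have mav N : measurable (av N).
  rewrite (_ : av N = \bigcap_(n in [set n | (N <= n)%N]) X n @^-1` [set~ y]).
    by apply: bigcap_measurable => [|k _]; [exists N => /=|exact: (walk_measurable X_walk)].
  by apply/seteqP; split=> w.
(* The history is extended vertex by vertex from time [n] to [N = n + k]. At [k = 0] the probability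
   is at most [avoid y M (s n)] for every [M], which tends to 0. *)
have av_null N k n s : (n + k)%N = N -> P (past n s `&` av N) = 0%E.
  elim: k n s => [|k IH] n s.
    rewrite addn0 => <-; apply/eqP; rewrite eq_le measure_ge0 andbT.
    apply/lee_addgt0Pr => e e0; rewrite add0e.
    have [M _ HM] : \forall M \near \oo, avoid y M (s n) < e.
      exact: (cvgr_lt _ (avoid0 (s n))).
    apply: (@le_trans _ _ (P (past n s `&` future n (fun=> [set~ y]) M))).
      apply: le_measure; rewrite ?inE.
      - by apply: measurableI => //; exact: measurable_past.
      - by apply: measurableI; [exact: measurable_past|exact: measurable_future].
      - by move=> w [pw aw]; split=> // j _; apply: aw; exact: leq_addr.
    rewrite prob_past_future avoidE.
    apply: (@le_trans _ _ (1 * (avoid y M (s n))%:E)%E).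
      apply: lee_wpmul2r; first by rewrite lee_fin avoid_ge0.
      by apply: probability_le1; exact: measurable_past.
    by rewrite mul1e lee_fin ltW//; exact: HM (leqnn M).
  rewrite addnS -addSn => nkN.
  rewrite (measure_esum_preimage P (X n.+1)); last 2 first.
  - exact: (walk_measurable X_walk).
  - by apply: measurableI => //; exact: measurable_past.
  apply: esum1 => z _; rewrite -(IH n.+1 (fun k => if k == n.+1 then z else s k) nkN).
  congr (P _); rewrite pastS eqxx setIAC; congr (_ `&` _); rewrite setIC.
  congr (_ `&` _); apply/seteqP; split=> w pw j jn; have := pw j jn;
  by have [jn'|//] := eqVneq j n.+1; move: jn; rewrite jn' ltnn.
have past0 : X 0%N @^-1` [set x] = past 0 (fun=> x).
  by apply/seteqP; split=> w /=; [move=> wx [|k]//|exact].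
have m0 : measurable (X 0%N @^-1` [set x]) by exact: (walk_measurable X_walk).
set io := [set w | _].
have ioE : ~` io = \bigcup_N av N.
  apply/seteqP; split=> w.
    move=> /existsNP[N HN]; exists N => // n Nn wy; apply: HN; by exists n.
  by move=> [N _ HN] /(_ N)[n Nn]; exact: HN.
have mio : measurable io.
  by rewrite -[io]setCK ioE; apply: measurableC; exact: bigcupT_measurable.
have null : P (X 0%N @^-1` [set x] `\` io) = 0%E.
  rewrite setDE ioE setI_bigcupr; apply/eqP; rewrite eq_le measure_ge0 andbT.
  apply: le_trans (measure_sigma_subadditive P _ _ (@subset_refl _ _)) _.
  - by move=> N; exact: measurableI.
  - by apply: bigcupT_measurable => N; exact: measurableI.
  - rewrite eseries0// => N _ _. rewrite past0.
    exact: (av_null N N 0%N).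
rewrite /cond_prob.
have -> : P (io `&` X 0%N @^-1` [set x]) = P (X 0%N @^-1` [set x]).
  have DI : (P (X 0%N @^-1` [set x]) = P (X 0%N @^-1` [set x] `\` io) +
      P (X 0%N @^-1` [set x] `&` io))%E by exact: measureDI.
  by rewrite [RHS]DI null add0e setIC.
rewrite mulfV// gt_eqF//; apply: fine_gt0.
by rewrite (walk_start X_walk) ltey_eq fin_num_measure.
Qed.

(** * Returns of the killed walk and Borel-Cantelli *)

Definition killed_at (K : {fset V}) x n (j : nat) : set V :=
  [set v | if (j < n)%N then v \in K else v == x].

(** Identifies the recursion [killed] with the probability of staying in [K] before time [n] and
    being at [x] at time [n]. *)
Lemma path_prob_killed (K : {fset V}) x n z : x \in K ->
  path_prob (killed_at K x n) n z = (killed (b := b) K x n z)%:E.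
Proof.
move=> xK; elim: n z => [|n IH] z.
  have E : (z \in killed_at K x 0 0) = (z == x).
    by apply/idP/idP => [/set_mem//|zx]; exact/mem_set.
  by rewrite /= mule1 E.
have shift : (fun j => killed_at K x n.+1 j.+1) = killed_at K x n.
  by apply/funext => j; rewrite /killed_at ltnS.
have KE : (z \in killed_at K x n.+1 0) = (z \in K).
  by apply/idP/idP => [/set_mem//|zK]; exact/mem_set.
rewrite [LHS]/= shift KE [in RHS]/= EFinM; congr (_ * _)%E.
rewrite -(esum_supp (fun z' => b z z' / dg z * killed (b := b) K x n z')); last 2 first.
- by move=> z'; rewrite mulr_ge0 ?step_prob_ge0 ?(killed_ge0 b_graph).
- move=> z' z'K; suff -> : killed (b := b) K x n z' = 0 by rewrite mulr0.
  case: n {IH shift KE} => [|n] /=; last by rewrite (negbTE z'K) mul0r.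
  by case: eqP z'K => // ->; rewrite xK.
by apply: eq_esum => z' _; rewrite IH EFinM.
Qed.

(** Bounded evaluation at [x] would bound the killed Green functions uniformly in the finite set.
    Exhausting [V] makes the return probabilities summable, so infinitely many returns would have
    probability 0. *)
Lemma zero_capacity_of_recurrent x : recurrent_walk P X ->
  zero_capacity b x.
Proof.
move=> rec [C HC].
(* The vertices with code below [j], together with [x]: an increasing exhaustion of [V] by finite
   sets. *)
pose K j := (x |` [fset z in pmap choice.unpickle (iota 0 j)])%fset.
have xK j : x \in K j by exact: fset1U1.
have memK j z : (choice.pickle z < j)%N -> z \in K j.
  move=> zj; rewrite !inE; apply/orP; right; rewrite mem_pmap.
  by apply/mapP; exists (choice.pickle z); rewrite ?mem_iota// choice.pickleK.
have subK j j' : (j <= j')%N -> (K j `<=` K j')%fset.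
  move=> jj'; apply: fsetUS; apply/fsubsetP => z; rewrite !inE !mem_pmap.
  move=> /mapP[k]; rewrite mem_iota => /andP[_ kj] ->; apply: map_f.
  by rewrite mem_iota/= (leq_trans kj).
pose s0 (_ : nat) := x.
pose E n := X 0%N @^-1` [set x] `&` X n @^-1` [set x].
(* Return at time [n] without leaving [K j] before; these events increase with [j] to [E n]. *)
pose F n j := past 0 s0 `&` future 0 (killed_at (K j) x n) n.
have mF n j : measurable (F n j).
  by apply: measurableI; [exact: measurable_past|exact: measurable_future].
have mE n : measurable (E n) by apply: measurableI; exact: (walk_measurable X_walk).
have FE n : \bigcup_j F n j = E n.
  apply/seteqP; split=> w.
    move=> [j _ [pw fw]]; split; first exact: (pw 0%N).
    by have := fw n (leqnn n); rewrite /killed_at/= ltnn add0n => /eqP.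
  (* The index exceeds the codes of all vertices visited before time [n]. *)
  move=> [w0 wn]; exists (\max_(k < n) choice.pickle (X k w)).+1 => //; split.
    by move=> k; rewrite leqn0 => /eqP ->.
  move=> k kn; rewrite add0n /killed_at/=; case: ltnP => [kn'|nk].
    by apply: memK; rewrite ltnS; exact: (leq_bigmax (Ordinal kn')).
  by have -> : k = n; [apply/eqP; rewrite eqn_leq kn|rewrite wn eqxx].
have ndF n : nondecreasing_seq (F n).
  move=> j j' jj'; apply/subsetPset => w [pw fw]; split=> // k kn.
  have := fw k kn; rewrite /killed_at/=; case: ltnP => // _.
  by apply/fsubsetP; exact: subK.
have PF n : P (F n j) @[j --> \oo] --> P (E n).
  by rewrite -FE; apply: nondecreasing_cvg_mu => //; rewrite FE.
set p0 := P (past 0 s0).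
have pfin : p0 \is a fin_num by apply: fin_num_measure; exact: measurable_past.
have sumE N : (\sum_(n < N) P (E n) <= p0 * (C * dg x)%:E)%E.
  have cvgN : (\sum_(n < N) P (F n j))%E @[j --> \oo] --> (\sum_(n < N) P (E n))%E.
    by apply: cvg_nnesum => n _; [apply: nearW => j|exact: PF].
  apply: (cvge_le _ cvgN); apply: nearW => j.
  rewrite (eq_bigr (fun n : 'I_N => p0 * (killed (b := b) (K j) x n x)%:E)%E); last first.
    by move=> n _; rewrite prob_past_future path_prob_killed.
  rewrite -ge0_sume_distrr; last first.
    by move=> n _; rewrite lee_fin (killed_ge0 b_graph).
  apply: lee_wpmul2l; first exact: measure_ge0.
  rewrite sumEFin lee_fin.
  exact: (killed_green_bound b_graph).
have series_fin : (\sum_(n <oo) P (E n) < +oo)%E.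
  apply: (@le_lt_trans _ _ (p0 * (C * dg x)%:E)%E); last first.
    by rewrite ltey_eq fin_numM.
  apply: lime_le; first by apply: is_cvg_nneseries => n _ _.
  by apply: nearW => N; rewrite big_mkord.
have io_null := lim_sup_set_cvg0 mE series_fin.
have := rec x x; rewrite /cond_prob (_ : _ `&` _ = lim_sup_set E).
  by rewrite io_null/= mul0r => /eqP; rewrite eq_sym oner_eq0.
apply/seteqP; split=> w.
  by move=> [io w0] N _; have [n Nn wn] := io N; exists n.
move=> H; split=> [N|]; first by have [n Nn [_ wn]] := H N I; exists n.
by have [n _ []] := H 0%N I.
Qed.

End Walk.

(** * Recurrence and capacity *)

Section SemigroupCapacity.
Context {R : realType} {V : countType} {b : V -> V -> R} {m : V -> R}.
Context {T : R -> (V -> R) -> (V -> R)}.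
Hypothesis b_graph : weighted_graph b (fun=> 0).
Hypothesis b_connected : connected_graph b.
Hypothesis m_gt0 : forall x, 0 < m x.
Hypothesis T_semigroup : semigroup_of m (op_LD b (fun=> 0) m) T.
Let m_ge0 x : 0 <= m x := ltW (m_gt0 x).

Local Notation Q := (energy_form b (fun=> 0)).
Local Notation ip := (l2inner m).

Lemma zero_capacity_of_recurrent_semigroup x : recurrent_semigroup T ->
  zero_capacity b x.
Proof.
move=> /(_ x x) rec [C HC].
have hd : in_l2 m (delta x) := in_l2_delta m_gt0 x.
have mx := m_gt0 x.
have E t : T `|t| (delta x) x = (m x)^-1 * ip (T `|t| (delta x)) (delta x).
  by rewrite l2inner_delta mulrC mulfK// gt_eqF.
have cT := T_pairing_continuous m_gt0 T_semigroup _ _ hd hd.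
(* [<delta x, phi> = phi x * m x] produces the factor [m x ^+ 2]; [|C|] supplies the nonnegative
   constant that [pairing_integ_le] expects. *)
pose C' := `|C| * m x ^+ 2.
have bound s : 0 <= s -> pairing_integ (m := m) (T := T) (delta x) s <= C'.
  move=> s0; apply: (pairing_integ_le b_graph m_gt0 T_semigroup) => //.
    by rewrite mulr_ge0 ?sqr_ge0.
  move=> phi fphi; rewrite l2innerC l2inner_delta exprMn [leRHS]mulrAC.
    rewrite ler_wpM2r ?sqr_ge0//; apply: le_trans (HC phi fphi) _.
  by rewrite ler_wpM2r ?(energy_form_ge0 b_graph)// ler_norm.
have := @integral_itvcy_le R (fun t => (m x)^-1 * ip (T `|t| (delta x)) (delta x) + 0)
  ((m x)^-1 * C').
have -> : (\int[lebesgue_measure]_(t in `[0%R, +oo[)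
    ((m x)^-1 * ip (T `|t| (delta x)) (delta x) + 0)%:E =
    \int[lebesgue_measure]_(t in `[0%R, +oo[) (T t (delta x) x)%:E)%E.
  apply: eq_integral => t; rewrite inE/= in_itv/= andbT => t0.
  by rewrite addr0 -E ger0_norm.
rewrite rec leye_eq /= => H; suff : false by [].
apply: H.
- by apply: continuous_lin => //; exact: cst_continuous.
- move=> t t0; rewrite addr0 mulr_ge0 ?invr_ge0// ger0_norm//.
  exact: (T_pairing_ge0 m_gt0 T_semigroup).
- move=> s s0; rewrite integ_lin//; last exact: cst_continuous.
  rewrite integ_cst// mul0r addr0 ler_wpM2l ?invr_ge0//; exact: bound.
Qed.

(** Pairing with the normalized point mass [f z] is evaluation at [z]. Polarization with
    [D = f x - f y] bounds [2 <T_t f x, f y>] below by [<T_t f x, f x> - <T_t D, D>]: the integral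
    of the first term diverges, that of the second stays bounded by connectedness. *)
Lemma recurrent_semigroup_of_zero_capacity :
  (forall z, zero_capacity b z) ->
  recurrent_semigroup T.
Proof.
move=> nocap x y.
pose f z : V -> R := fun v => (m z)^-1 * delta z v.
have hf z : in_l2 m (f z) by apply: (in_l2Z m_ge0); exact: in_l2_delta.
have ipf z g : in_l2 m g -> ip g (f z) = g z.
  move=> hg; rewrite (l2innerZr m_ge0)//; last exact: in_l2_delta.
  by rewrite l2inner_delta mulrC mulfK// gt_eqF.
pose D := f x \- f y.
have hD : in_l2 m D by exact: (in_l2B m_ge0).
have [C C0 HC] := connected_energy_bound b_graph b_connected x y.
have boundD (s : R) : 0 <= s -> pairing_integ (m := m) (T := T) D s <= C.
  move=> s0; apply: (pairing_integ_le b_graph m_gt0 T_semigroup) => // phi fphi.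
  have [Ephi hphi _] := finitely_supported_dom b_graph m_gt0 phi fphi.
  by rewrite l2innerC (l2innerBr m_ge0)// !ipf//; exact: HC.
(* A bound [M] would bound evaluation at [x] by [M] times the energy, against zero capacity. *)
have unbound M : exists2 s : R, 0 <= s & M < pairing_integ (m := m) (T := T) (f x) s.
  apply: contrapT => H; apply: (nocap x); exists M => phi fphi.
  have [_ hphi _] := finitely_supported_dom b_graph m_gt0 phi fphi.
  rewrite -(ipf x)// l2innerC.
  apply: (pairing_le_of_pairing_integ b_graph m_gt0 T_semigroup) => // s s0.
  by rewrite leNgt; apply/negP => Ms; apply: H; exists s.
have mx := m_gt0 x.
(* The factor [m x] comes from [delta x = m x * f x], the 2 from polarization. *)
pose k := m x / 2; have k0 : 0 < k by rewrite divr_gt0.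
pose A g (t : R) : R := ip (T `|t| g) g.
have cA g : in_l2 m g -> continuous (A g).
  by move=> hg; exact: (T_pairing_continuous m_gt0 T_semigroup).
have ckA g : in_l2 m g -> continuous (fun t => k * A g t + 0).
  by move=> hg; apply: continuous_lin; [exact: cA|exact: cst_continuous].
have integ_kA g s : 0 <= s -> in_l2 m g ->
    integ (fun t => k * A g t + 0) s = k * pairing_integ (m := m) (T := T) g s.
  move=> s0 hg; rewrite integ_lin//; [|exact: cA|exact: cst_continuous].
  by rewrite integ_cst// mul0r addr0.
have A_ge0 g t : 0 <= t -> in_l2 m g -> 0 <= A g t.
  by move=> t0 hg; rewrite /A ger0_norm//; exact: (T_pairing_ge0 m_gt0 T_semigroup).
rewrite (_ : (\int[_]_(t in _) _)%E =
    (\int[lebesgue_measure]_(t in `[0%R, +oo[) (T `|t| (delta x) y)%:E)%E); last first.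
  by apply: eq_integral => t; rewrite inE/= in_itv/= andbT => t0; rewrite ger0_norm.
apply: (@integral_itvcy_pinfty R _ (fun t => k * A (f x) t + 0)
  (fun t => k * A D t + 0) (k * C)).
- exact: (T_coord_continuous m_gt0 T_semigroup _ _ (in_l2_delta m_gt0 x)).
- exact: ckA.
- exact: ckA.
- move=> t t0; rewrite !addr0; split; rewrite ?mulr_ge0 ?A_ge0 ?(ltW k0)//.
  have hT z := T_l2 T_semigroup t (f z) t0 (hf z).
  have TD : A D t = A (f x) t + A (f y) t - 2 * T t (f x) y.
    rewrite /A /D ger0_norm// (T_sub T_semigroup)//.
    rewrite (l2innerBr m_ge0)//; last exact: (in_l2B m_ge0).
    rewrite !(l2innerBl m_ge0)//.
    rewrite (semigroup_symmetric T_semigroup t0 (hf y) (hf x)) (l2innerC (f y)).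
    by rewrite !(ipf y)//; ring.
  have Tf : T t (delta x) y = m x * T t (f x) y.
    rewrite /f (T_scale m_gt0 T_semigroup)//; last exact: in_l2_delta.
    by rewrite mulrA mulfV ?mul1r// gt_eqF.
  rewrite ger0_norm// Tf TD.
  have := A_ge0 (f y) t t0 (hf y); rewrite -subr_ge0.
  have -> : m x * T t (f x) y = k * (2 * T t (f x) y) by rewrite /k; field.
  by rewrite subr0 -mulrBr ler_pM2l//; lra.
- by move=> s s0; rewrite integ_kA// ler_pM2l// boundD.
- move=> M; have [s s0 Ms] := unbound (M / k).
  by exists s => //; rewrite integ_kA// mulrC -ltr_pdivrMr.
Qed.

End SemigroupCapacity.

Theorem corollary3p6 (R : realType) (V : countType)
  (b : V -> V -> R) (m : V -> R)
  (d : measure_display) (Omega : measurableType d) (P : probability Omega R)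
  (X : nat -> Omega -> V) (T : R -> (V -> R) -> (V -> R))
  (V_infinite : infinite_set [set: V])
  (b_graph : weighted_graph b (fun=> 0))
  (b_connected : connected_graph b)
  (m_gt0 : forall x, 0 < m x)
  (X_walk : random_walk b P X)
  (T_semigroup : semigroup_of m (op_LD b (fun=> 0) m) T) :
  recurrent_walk P X <-> recurrent_semigroup T.
Proof.
have dg_gt0 := connected_deg_gt0 b_graph V_infinite b_connected.
split=> rec.
  apply: (recurrent_semigroup_of_zero_capacity b_graph b_connected m_gt0 T_semigroup).
  by move=> z; exact: (zero_capacity_of_recurrent b_graph X_walk dg_gt0).
apply: (recurrent_of_zero_capacity b_graph X_walk dg_gt0 b_connected) => z.
exact: (zero_capacity_of_recurrent_semigroup b_graph m_gt0 T_semigroup).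
Qed.
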